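(* Up to $\Gamma$-conjugacy, the strongly admissible sets $\mathcal{I}\subset\mathcal{P}$ with $|\mathcal{I}|>1$ are exactly $\mathcal{I}^2_1,\ \mathcal{I}^2_2,\ \mathcal{I}^3_1,\ \mathcal{I}^3_2,\ \mathcal{I}^3_3,\ \mathcal{I}^4_1,\ \mathcal{I}^4_2,\ \mathcal{I}^5,\ \mathcal{I}^8$.
   Context: Let $H=\begin{pmatrix}0&0&i\\0&-1&0\\-i&0&0\end{pmatrix}$, $G=\mathrm{SU}(2,1)=\{g\in \mathrm{SL}(3,\mathbb{C}) : g^*Hg=H\}$, $\mathcal{Q}(u,v)=u^*Hv$ on $\mathbb{C}^3$, $\Gamma=G\cap \mathrm{SL}_3(\mathbb{Z}[i])$. Let $K=\{g\in G:(g^* )^{-1}=g\}$, $D=G/K$, $x_0=eK$. Every $z\in D$ is uniquely $z=u\,a\cdot x_0$ with $u=\begin{pmatrix}1&\beta&r+i|\beta|^2/2\\0&1&i\overline\beta\\0&0&1\end{pmatrix}$, $a=\mathrm{diag}(y,1,1/y)$, $\beta\in\mathbb{C}$, $r\in\mathbb{R}$, $y>0$; write $z=(y,\beta,r)$. $\mathcal{P}$ is the set of proper rational parabolic subgroups of $G$. Each $P\in\mathcal{P}$ is the stabilizer of the line spanned by a vector $v_P=(n,p,q)^t\in\mathbb{Z}[i]^3$ that is isotropic ($\mathcal{Q}(v_P,v_P)=0$) and reduced ($n,p,q$ generate the unit ideal), unique up to units $\{\pm1,\pm i\}$; this is a bijection between $\mathcal{P}$ and reduced isotropic vectors up to units.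 $\Gamma$ acts on $\mathcal{P}$ by conjugation, ${}^\gamma P=\gamma P\gamma^{-1}$, and $v_{{}^\gamma P}=\gamma v_P$; two subsets of $\mathcal{P}$ are $\Gamma$-conjugate if an element of $\Gamma$ carries one onto the other. The exhaustion function of $P$ with $v_P=(n,p,q)^t$ is $$f_P(y,\beta,r)=\frac{y}{\left(|n-\beta p+(i|\beta|^2/2-r)q|^2+y^2|p-i\overline\beta q|^2+y^4|q|^2\right)^{1/2}}.$$ Let $D(P)=\{z\in D: f_P(z)\ge f_Q(z)\ \forall Q\in\mathcal{P}\setminus\{P\}\}$, and for $\mathcal{I}\subseteq\mathcal{P}$ let $D(\mathcal{I})=\bigcap_{P\in\mathcal{I}}D(P)$ and $D'(\mathcal{I})=D(\mathcal{I})\setminus\bigcup_{\mathcal{I}'\supsetneq\mathcal{I}}D(\mathcal{I}')$. The set $\mathcal{I}$ is strongly admissible if $D'(\mathcal{I})\ne\emptyset$. (The spine is $D_0=\coprod_{|\mathcal{I}|>1}D'(\mathcal{I})$.) $\mathcal{I}^i_j$ denotes the set of rational parabolic subgroups associated to the following set $\mathcal{J}^i_j$ of reduced isotropic vectors: $\mathcal{J}^2_1=\{(1,0,0)^t,(0,0,1)^t\}$, $\mathcal{J}^2_2=\{(1,0,0)^t,(i,1+i,1+i)^t\}$, $\mathcal{J}^3_1=\mathcal{J}^2_1\cup\{(1,0,1)^t\}$, $\mathcal{J}^3_2=\mathcal{J}^2_1\cup\{(i,1+i,1)^t\}$, $\mathcal{J}^3_3=\mathcal{J}^2_1\cup\{(1+i,1+i,1)^t\}$,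 $\mathcal{J}^4_1=\mathcal{J}^3_1\cup\{(i,1+i,1)^t\}$, $\mathcal{J}^4_2=\mathcal{J}^3_3\cup\{(-1,-1+i,1+i)^t\}$, $\mathcal{J}^5=\mathcal{J}^4_1\cup\{(1+i,1+i,1)^t\}$, $\mathcal{J}^8=\{(1,0,0)^t,(0,0,1)^t,(-1,1+i,1+i)^t,(-1+i,1+i,1)^t,(1+i,1-i,1)^t,(i,1+i,1+i)^t,(2i,2,1)^t,(i,2,2)^t\}$. *)

(* Defs.v *)
From HB Require Import structures.
From mathcomp Require Import all_boot all_order all_algebra.
From mathcomp Require Import sesquilinear spectral complex.
From mathcomp Require Import boolp classical_sets functions cardinality reals.

Set Implicit Arguments.
Unset Strict Implicit.
Unset Printing Implicit Defensive.

Import Order.TTheory GRing.Theory Num.Theory.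

Local Open Scope classical_set_scope.
Local Open Scope ring_scope.
Local Open Scope sesquilinear_scope.

Section PicardSpine.
Variable R : realType.
Local Notation C := R[i].
Implicit Types (g : 'M[C]_3) (v : 'cV[C]_3) (P Q : set 'M[C]_3)
  (I : set (set 'M[C]_3)).

Definition mx3 (rows : seq (seq C)) : 'M[C]_3 :=
  \matrix_(i, j) nth 0 (nth [::] rows i) j.

Definition vec3 (n p q : C) : 'cV[C]_3 := \col_i nth 0 [:: n; p; q] i.

Definition Hmx : 'M[C]_3 :=
  mx3 [:: [:: 0; 0; 'i];
          [:: 0; -1; 0];
          [:: - 'i; 0; 0]].

Definition SU21 : set 'M[C]_3 :=
  [set g | \det g = 1 /\ g ^t* *m Hmx *m g = Hmx].

Definition hermQ (u v : 'cV[C]_3) : C := (u ^t* *m Hmx *m v) 0 0.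

Definition gaussInt (z : C) : bool :=
  (complex.Re z \is a Num.int) && (complex.Im z \is a Num.int).

Definition Gamma : set 'M[C]_3 :=
  [set g | SU21 g /\ forall i j, gaussInt (g i j)].

Definition maxK : set 'M[C]_3 := [set g | SU21 g /\ invmx (g ^t*) = g].

(* A point of D = G/K is a left coset gK, as a set of matrices. *)
Definition cosetK g : set 'M[C]_3 := [set g *m k | k in maxK].

Definition symD : set (set 'M[C]_3) := [set cosetK g | g in SU21].

Definition umx (beta : C) (r : R) : 'M[C]_3 :=
  mx3 [:: [:: 1; beta; r%:C%C + 'i * `|beta| ^+ 2 / 2];
          [:: 0; 1; 'i * beta^*];
          [:: 0; 0; 1]].

Definition amx (y : R) : 'M[C]_3 :=
  mx3 [:: [:: y%:C%C; 0; 0];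
          [:: 0; 1; 0];
          [:: 0; 0; (y^-1)%:C%C]].

(* The coordinates (y, beta, r) of the point z = u a x_0. They exist and are
   unique for z in symD, so the default value of xget is irrelevant. *)
Definition coords (z : set 'M[C]_3) : R * C * R :=
  xget (1, 0, 0) [set c | let: (y, beta, r) := c in
                          0 < y /\ z = cosetK (umx beta r *m amx y)].

Definition reduced_isotropic v : Prop :=
  [/\ forall i, gaussInt (v i 0),
      hermQ v v = 0 &
      exists w : 'cV[C]_3,
        (forall i, gaussInt (w i 0)) /\ \sum_i w i 0 * v i 0 = 1].

(* For v != 0 and g invertible, g v = c v means that g maps the line C v
   onto itself. *)
Definition line_stab v : set 'M[C]_3 :=
  [set g | SU21 g /\ exists c : C, g *m v = c *: v].

Definition parabolics : set (set 'M[C]_3) :=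
  [set line_stab v | v in reduced_isotropic].

(* A vector v_P: it is unique up to a unit of Z[i], and the exhaustion function
   does not depend on that unit. *)
Definition vecP P : 'cV[C]_3 :=
  xget 0 [set v | reduced_isotropic v /\ P = line_stab v].

Definition exhaustion P (z : set 'M[C]_3) : R :=
  let: (y, beta, r) := coords z in
  let n := vecP P 0 0 in let p := vecP P 1 0 in let q := vecP P 2 0 in
  let abs := @Normc.normc R in
  y / Num.sqrt
    (abs (n - beta * p + ('i * `|beta| ^+ 2 / 2 - r%:C%C) * q) ^+ 2
     + y ^+ 2 * abs (p - 'i * beta^* * q) ^+ 2
     + y ^+ 4 * abs q ^+ 2).

Definition domP P : set (set 'M[C]_3) :=
  [set z | symD z /\
     forall Q, parabolics Q -> Q <> P -> exhaustion Q z <= exhaustion P z].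

Definition domI I : set (set 'M[C]_3) := symD `&` \bigcap_(P in I) domP P.

Definition domI' I : set (set 'M[C]_3) :=
  domI I `\` \bigcup_(I' in [set I' | I' `<=` parabolics /\ I `<` I']) domI I'.

Definition strongly_admissible I : Prop :=
  I `<=` parabolics /\ domI' I !=set0.

Definition conjP (gamma : 'M[C]_3) P : set 'M[C]_3 :=
  [set gamma *m g *m invmx gamma | g in P].

Definition Gamma_conjugate I I' : Prop :=
  exists2 gamma, Gamma gamma & [set conjP gamma P | P in I] = I'.

Definition parabolics_of (J : seq 'cV[C]_3) : set (set 'M[C]_3) :=
  [set line_stab v | v in [set` J]].

Definition J2_1 := [:: vec3 1 0 0; vec3 0 0 1].
Definition J2_2 := [:: vec3 1 0 0; vec3 'i (1 + 'i) (1 + 'i)].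
Definition J3_1 := rcons J2_1 (vec3 1 0 1).
Definition J3_2 := rcons J2_1 (vec3 'i (1 + 'i) 1).
Definition J3_3 := rcons J2_1 (vec3 (1 + 'i) (1 + 'i) 1).
Definition J4_1 := rcons J3_1 (vec3 'i (1 + 'i) 1).
Definition J4_2 := rcons J3_3 (vec3 (-1) (-1 + 'i) (1 + 'i)).
Definition J5 := rcons J4_1 (vec3 (1 + 'i) (1 + 'i) 1).
Definition J8 :=
  [:: vec3 1 0 0; vec3 0 0 1; vec3 (-1) (1 + 'i) (1 + 'i);
      vec3 (-1 + 'i) (1 + 'i) 1; vec3 (1 + 'i) (1 - 'i) 1;
      vec3 'i (1 + 'i) (1 + 'i); vec3 (2 * 'i) 2 1; vec3 'i 2 2].

Definition representatives : seq (seq 'cV[C]_3) :=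
  [:: J2_1; J2_2; J3_1; J3_2; J3_3; J4_1; J4_2; J5; J8].

End PicardSpine.

(* Main.v *)
Require Import Defs.
From mathcomp Require Import all_boot all_order all_algebra.
From mathcomp Require Import sesquilinear complex ring lra zify.
From mathcomp Require Import boolp classical_sets functions cardinality reals.

Set Implicit Arguments.
Unset Strict Implicit.
Unset Printing Implicit Defensive.

Import Order.TTheory GRing.Theory Num.Theory.

Local Open Scope classical_set_scope.
Local Open Scope card_scope.
Local Open Scope ring_scope.
Local Open Scope sesquilinear_scope.

(* For w in C^3 with Q(w, w) > 0 put F(v) = |Q(v, w)|^2. If w spans the positive line
   of the point z of D, then f_P(z)^-2 is proportional to F(v_P), so the strongly
   admissible sets are the sets Min(w) of reduced isotropic vectors (up to units)
   minimising F. Put h = Q(w, w) / (2 min F). Nonnegativity of the Gram determinant of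
   (u, v, w) gives |Q(u, v)| h <= 1 for u, v in Min(w), while a covering argument in the
   Heisenberg group gives h >= 1/2, with equality only at the Gamma-translates of
   (i, 1, 1), whose minimal vectors are J^8.
   If h > 1/2, then |Q(u, v)|^2 is 1 or 2 for any two vectors of Min(w). If 1 occurs,
   the pair can be moved to (1, 0, 0), (0, 0, 1); up to units only 22 other vectors
   have |Q|^2 <= 2 with both, and each of the 111 sets of pairwise compatible vectors
   among them is Gamma-equivalent to one on the list, so that no further inequality is
   needed. If only 2 occurs, a parity argument leaves J^2_2.
   Conversely the sets on the list are Min(w) for explicit w, and they are told apart
   by the numbers |Q(u, v)|^2 and |det(u, v, v')|^2. *)

(** * The Hermitian form *)

(** Scaling w changes no comparison, so points of D are handled as positive vectors; the coordinates
    (y, beta, r) enter only once, through a vector with Q(w, w) = 2 y^2 and F(v_P) = (y / f_P)^2, so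
    that h is the square of the largest exhaustion value. Finiteness rests on a gap among Gaussian
    norms: h > 1/2 gives |Q(u, v)|^2 < 4, and 3 is not a norm. The delicate case is h = 1/2, where
    the value 4 is no longer excluded; the covering argument confines it to a single orbit of
    points. *)

Section HermitianForm.
Variable R : realType.
Local Notation C := R[i].
Implicit Types (g : 'M[C]_3) (u v w : 'cV[C]_3).

Definition nsq (z : C) : R := complex.Re z ^+ 2 + complex.Im z ^+ 2.

Lemma nsqM (x y : C) : nsq (x * y) = nsq x * nsq y.
Proof. by case: x y => [a b] [c d]; rewrite /nsq /=; ring. Qed.

Lemma nsq_ge0 (x : C) : 0 <= nsq x.
Proof. by rewrite addr_ge0 ?sqr_ge0. Qed.

Lemma nsq_eq0 (x : C) : (nsq x == 0) = (x == 0).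
Proof. by case: x => a b; rewrite /nsq paddr_eq0 ?sqr_ge0// !sqrf_eq0 eq_complex. Qed.

Lemma nsq_gt0 (x : C) : (0 < nsq x) = (x != 0).
Proof. by rewrite lt_def nsq_ge0 nsq_eq0 andbT. Qed.

Lemma nsq_conj (x : C) : nsq x^* = nsq x.
Proof. by case: x => a b; rewrite /nsq /= sqrrN. Qed.

Lemma nsqE (x : C) : x^* * x = (nsq x)%:C%C.
Proof.
by case: x => a b; apply/eqP; rewrite eq_complex /nsq /=; apply/andP; split; apply/eqP; ring.
Qed.

Lemma nsq1 : nsq 1 = 1.
Proof. by rewrite /nsq /=; ring. Qed.

Lemma normc_nsq (x : C) : Normc.normc x ^+ 2 = nsq x.
Proof. by case: x => a b; rewrite /= sqr_sqrtr// addr_ge0 ?sqr_ge0. Qed.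

Lemma iE : 'i = (0 +i* 1)%C :> C.
Proof. by rewrite -complexiE. Qed.

Lemma ord3_cases (i : 'I_3) : [\/ i = 0, i = 1 | i = 2].
Proof.
case: i => [[|[|[|//]]]] Hi; [apply: Or31|apply: Or32|apply: Or33]; exact/val_inj.
Qed.

Lemma cV3_eq u v : u 0 0 = v 0 0 -> u 1 0 = v 1 0 -> u 2 0 = v 2 0 -> u = v.
Proof.
move=> e0 e1 e2; apply/matrixP => i j; rewrite (ord1 j).
by case: (ord3_cases i) => ->.
Qed.

Lemma M3_eq (A B : 'M[C]_3) :
  (forall j, A 0 j = B 0 j) -> (forall j, A 1 j = B 1 j) -> (forall j, A 2 j = B 2 j) -> A = B.
Proof.
move=> e0 e1 e2; apply/matrixP => i j.
by case: (ord3_cases i) => ->.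
Qed.

Lemma sum3 (V : nmodType) (f : 'I_3 -> V) : \sum_i f i = f 0 + f 1 + f 2.
Proof.
rewrite !big_ord_recl big_ord0 addr0 addrA.
by congr (f _ + f _ + f _); apply/val_inj.
Qed.

Lemma vec3_id v : vec3 (v 0 0) (v 1 0) (v 2 0) = v.
Proof. by apply: cV3_eq; rewrite mxE. Qed.

Lemma vec3_0 (a b c : C) : vec3 a b c 0 0 = a. Proof. by rewrite mxE. Qed.
Lemma vec3_1 (a b c : C) : vec3 a b c 1 0 = b. Proof. by rewrite mxE. Qed.
Lemma vec3_2 (a b c : C) : vec3 a b c 2 0 = c. Proof. by rewrite mxE. Qed.

Definition vec3E := (vec3_0, vec3_1, vec3_2).

Lemma hermQE u v :
  hermQ u v = 'i * (u 0 0)^* * v 2 0 - (u 1 0)^* * v 1 0 - 'i * (u 2 0)^* * v 0 0.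
Proof.
rewrite /hermQ !mxE sum3 !mxE !sum3 !mxE /=; ring.
Qed.

Lemma hermQ_vec3 (a b c d e f : C) :
  hermQ (vec3 a b c) (vec3 d e f) = 'i * a^* * f - b^* * e - 'i * c^* * d.
Proof. by rewrite hermQE !vec3E. Qed.

Lemma hermQZl (c : C) u v : hermQ (c *: u) v = c^* * hermQ u v.
Proof. by rewrite !hermQE !mxE !rmorphM; ring. Qed.

Lemma hermQZr (c : C) u v : hermQ u (c *: v) = c * hermQ u v.
Proof. by rewrite !hermQE !mxE; ring. Qed.

Lemma conj_i : 'i^* = - 'i :> C.
Proof. by rewrite iE; apply/eqP; rewrite eq_complex /= oppr0 !eqxx. Qed.

Lemma hermQC u v : (hermQ u v)^* = hermQ v u.
Proof.
rewrite !hermQE !rmorphB !rmorphM /= ![in LHS]conjCK.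
by rewrite (_ : _ 'i = - 'i :> C) ?conj_i //; ring.
Qed.

Lemma Hmx_sqr : Hmx R *m Hmx R = 1%:M.
Proof.
have ii : 'i * 'i = -1 :> C by rewrite -expr2 sqrCi.
apply: M3_eq => j; rewrite !mxE sum3 !mxE; case: (ord3_cases j) => ->; rewrite /=.
all: by rewrite ?(mulr0,mul0r,addr0,add0r,mulrN,mulNr,ii,opprK,mulr1).
Qed.

Lemma SU21_hermQ g u v : SU21 g -> hermQ (g *m u) (g *m v) = hermQ u v.
Proof.
move=> [_ gH]; rewrite /hermQ trmx_mul map_mxM -!mulmxA (mulmxA (Hmx R)).
by rewrite (mulmxA (g ^t*)) mulmxA (mulmxA (g^t*)) gH !mulmxA.
Qed.

Lemma SU21_unit g : SU21 g -> g \in unitmx.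
Proof. by move=> [d1 _]; rewrite unitmxE d1 unitr1. Qed.

(** H is its own inverse, so the form equation itself exhibits the inverse of g. Its entries are
    Gaussian when those of g are, which is how [Gamma] is closed under inverses. *)
Lemma SU21_inv g : SU21 g -> invmx g = Hmx R *m g ^t* *m Hmx R.
Proof.
move=> Sg; have Ug := SU21_unit Sg; case: Sg => _ gH.
have e : (Hmx R *m g ^t* *m Hmx R) *m g = 1%:M.
  by rewrite -!mulmxA (mulmxA (g ^t*)) gH Hmx_sqr.
by rewrite -[LHS]mul1mx -e mulmxK.
Qed.

Lemma SU21_1 : SU21 (1%:M : 'M[C]_3).
Proof. by split; rewrite ?det1// trmx1 map_mx1 mul1mx mulmx1. Qed.

Lemma SU21_mul g h : SU21 g -> SU21 h -> SU21 (g *m h).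
Proof.
move=> [dg gH] [dh hH]; split; first by rewrite det_mulmx dg dh mulr1.
rewrite trmx_mul map_mxM -!mulmxA (mulmxA (Hmx R)) (mulmxA (g ^t*)) (mulmxA (g ^t*)).
by rewrite gH mulmxA hH.
Qed.

Lemma SU21_invmx g : SU21 g -> SU21 (invmx g).
Proof.
move=> Sg; have Ug := SU21_unit Sg; have := Sg => -[dg gH].
split; first by rewrite det_inv dg invr1.
have e : (invmx g) ^t* *m g ^t* = 1%:M.
  by rewrite -map_mxM -trmx_mul mulmxV// trmx1 map_mx1.
rewrite -[in LHS]gH -!mulmxA mulmxV// mulmx1 mulmxA e mul1mx //.
Qed.

Definition absQ2 v w : R := nsq (hermQ v w).

Lemma absQ2_ge0 v w : 0 <= absQ2 v w. Proof. exact: nsq_ge0. Qed.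

Lemma absQ2_act g v w : SU21 g -> absQ2 (g *m v) (g *m w) = absQ2 v w.
Proof. by move=> Sg; rewrite /absQ2 SU21_hermQ. Qed.

Lemma absQ2_Zl (c : C) v w : nsq c = 1 -> absQ2 (c *: v) w = absQ2 v w.
Proof. by move=> c1; rewrite /absQ2 hermQZl nsqM nsq_conj c1 mul1r. Qed.

Lemma absQ2_Zr (c : C) v w : absQ2 v (c *: w) = nsq c * absQ2 v w.
Proof. by rewrite /absQ2 hermQZr nsqM. Qed.

Definition Qre w : R := complex.Re (hermQ w w).

Lemma hermQ_self w : hermQ w w = (Qre w)%:C%C.
Proof.
have := hermQC w w; rewrite /Qre; case: (hermQ w w) => a b [] e.
by rewrite /= /real_complex_def; congr Complex; lra.
Qed.

Lemma Qre_act g w : SU21 g -> Qre (g *m w) = Qre w.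
Proof. by move=> Sg; rewrite /Qre SU21_hermQ. Qed.

Lemma Qre_Z (c : C) w : Qre (c *: w) = nsq c * Qre w.
Proof.
rewrite /Qre hermQZl hermQZr hermQ_self mulrA nsqE /=; ring.
Qed.

End HermitianForm.

(** * Integral vectors and matrices *)

(** Gaussian integers are doubled by pairs of integers because the finite checks are run by
    [vm_compute], which cannot evaluate arithmetic in [R[i]]. *)
Definition gint := (int * int)%type.
Definition ivec := (gint * gint * gint)%type.
Definition imat := (ivec * ivec * ivec)%type.

Definition gadd (x y : gint) : gint := (x.1 + y.1, x.2 + y.2).
Definition gopp (x : gint) : gint := (- x.1, - x.2).
Definition gmul (x y : gint) : gint := (x.1 * y.1 - x.2 * y.2, x.1 * y.2 + x.2 * y.1).
Definition gconj (x : gint) : gint := (x.1, - x.2).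
Definition gmuli (x : gint) : gint := (- x.2, x.1).
Definition inorm (x : gint) : int := x.1 * x.1 + x.2 * x.2.

Definition iscale (c : gint) (v : ivec) : ivec :=
  (gmul c v.1.1, gmul c v.1.2, gmul c v.2).
Definition iaddv (u v : ivec) : ivec :=
  (gadd u.1.1 v.1.1, gadd u.1.2 v.1.2, gadd u.2 v.2).
Definition iQ (u v : ivec) : gint :=
  gadd (gadd (gmuli (gmul (gconj u.1.1) v.2)) (gopp (gmul (gconj u.1.2) v.1.2)))
       (gopp (gmuli (gmul (gconj u.2) v.1.1))).

(* An element of [imat] is the triple of its columns. *)
Definition iapp (m : imat) (v : ivec) : ivec :=
  iaddv (iaddv (iscale v.1.1 m.1.1) (iscale v.1.2 m.1.2)) (iscale v.2 m.2).
Definition idet (m : imat) : gint :=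
  let: (a, b, c) := m in
  gadd (gadd
    (gmul a.1.1 (gadd (gmul b.1.2 c.2) (gopp (gmul b.2 c.1.2))))
    (gopp (gmul a.1.2 (gadd (gmul b.1.1 c.2) (gopp (gmul b.2 c.1.1))))))
    (gmul a.2 (gadd (gmul b.1.1 c.1.2) (gopp (gmul b.1.2 c.1.1)))).

Definition ie1 : ivec := ((1, 0), (0, 0), (0, 0)).
Definition ie2 : ivec := ((0, 0), (1, 0), (0, 0)).
Definition ie3 : ivec := ((0, 0), (0, 0), (1, 0)).

(** The nine values of [iQ] form the Gram matrix of the columns, compared with H entry by entry. *)
Definition iGamma (m : imat) : bool :=
  let: (a, b, c) := m in
  [&& iQ a a == (0, 0), iQ a b == (0, 0), iQ a c == (0, 1),
      iQ b a == (0, 0), iQ b b == (-1, 0), iQ b c == (0, 0),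
      iQ c a == (0, -1), iQ c b == (0, 0), iQ c c == (0, 0) & idet m == (1, 0)].

Definition iunits : seq gint := [:: (1, 0); (0, 1); (-1, 0); (0, -1)].

Section IntegralModel.
Variable R : realType.
Local Notation C := R[i].

Definition gC (x : gint) : C := (x.1%:~R +i* x.2%:~R)%C.
Definition vC (v : ivec) : 'cV[C]_3 := vec3 (gC v.1.1) (gC v.1.2) (gC v.2).
Definition mC (m : imat) : 'M[C]_3 :=
  \matrix_(i, j) (nth 0 [:: vC m.1.1; vC m.1.2; vC m.2] j) i 0.

Ltac cplx := apply/eqP;
  rewrite eq_complex /= ?(intrD, intrN, intrM, rmorphB, rmorphD, rmorphM, rmorphN) /=;
  apply/andP; split; apply/eqP; ring.

Lemma gC_add x y : gC (gadd x y) = gC x + gC y.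
Proof. by case: x y => [a b] [c d]; rewrite /gC /gadd; cplx. Qed.
Lemma gC_opp x : gC (gopp x) = - gC x.
Proof. by case: x => [a b]; rewrite /gC /gopp; cplx. Qed.
Lemma gC_mul x y : gC (gmul x y) = gC x * gC y.
Proof. by case: x y => [a b] [c d]; rewrite /gC /gmul; cplx. Qed.
Lemma gC_conj x : gC (gconj x) = (gC x)^*.
Proof. by case: x => [a b]; rewrite /gC /gconj; cplx. Qed.
Lemma gC_muli x : gC (gmuli x) = 'i * gC x.
Proof. by case: x => [a b]; rewrite iE /gC /gmuli; cplx. Qed.
Lemma gC_inj : injective gC.
Proof.
by move=> [a b] [c d] [] /eqP; rewrite eqr_int => /eqP -> /eqP; rewrite eqr_int => /eqP ->.
Qed.
Lemma gC0 : gC (0, 0) = 0. Proof. by []. Qed.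
Lemma gC1 : gC (1, 0) = 1. Proof. by []. Qed.
Lemma gCi : gC (0, 1) = 'i. Proof. by rewrite iE. Qed.
Lemma gCN1 : gC (-1, 0) = -1.
Proof. by rewrite -gC1 -gC_opp. Qed.

Lemma gCNi : gC (0, -1) = - 'i.
Proof. by rewrite -gCi -gC_opp. Qed.

Lemma nsq_gC x : nsq (gC x) = (inorm x)%:~R.
Proof. by case: x => a b; rewrite /nsq /inorm /= rmorphD !rmorphM /= !expr2. Qed.

Lemma vC_inj : injective vC.
Proof.
move=> [[a b] c] [[d e] f] /matrixP E.
have := (E 0 0, E 1 0, E 2 0); rewrite !mxE /=.
by case; case => /gC_inj -> /gC_inj -> /gC_inj ->.
Qed.

Lemma vC_scale c v : vC (iscale c v) = gC c *: vC v.
Proof. by apply: cV3_eq; rewrite !mxE /= gC_mul. Qed.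

Lemma iQP u v : hermQ (vC u) (vC v) = gC (iQ u v).
Proof.
rewrite hermQ_vec3 /iQ !(gC_add, gC_opp, gC_muli, gC_mul, gC_conj); ring.
Qed.

Lemma iappP m v : vC (iapp m v) = mC m *m vC v.
Proof.
by apply: cV3_eq; rewrite !mxE sum3 !mxE /= !gC_add !gC_mul; ring.
Qed.

Lemma det3 (A : 'M[C]_3) : \det A =
  A 0 0 * (A 1 1 * A 2 2 - A 2 1 * A 1 2) - A 1 0 * (A 0 1 * A 2 2 - A 2 1 * A 0 2)
  + A 2 0 * (A 0 1 * A 1 2 - A 1 1 * A 0 2).
Proof.
have det2 (B : 'M[C]_2) : \det B = B 0 0 * B 1 1 - B 1 0 * B 0 1.
  rewrite (expand_det_col _ 0) !big_ord_recl big_ord0 /cofactor !det_mx11 !mxE /=.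
  have -> : lift 0 0 = 1 :> 'I_2 by apply: val_inj.
  have -> : lift 1 0 = 0 :> 'I_2 by apply: val_inj.
  rewrite addr0 /bump /= !addn0 !expr0 expr1; ring.
have l00 : lift 0 0 = 1 :> 'I_3 by apply: val_inj.
have l01 : lift 0 1 = 2 :> 'I_3 by apply: val_inj.
have l10 : lift 1 0 = 0 :> 'I_3 by apply: val_inj.
have l11 : lift 1 1 = 2 :> 'I_3 by apply: val_inj.
have l20 : lift 2 0 = 0 :> 'I_3 by apply: val_inj.
have l21 : lift 2 1 = 1 :> 'I_3 by apply: val_inj.
rewrite (expand_det_col A 0) sum3 /cofactor !det2 !mxE l00 l01 l10 l11 l20 l21 /=.
rewrite /bump /= !addn0 !expr0 expr1 sqrrN expr1n; ring.
Qed.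

Lemma det_mC m : \det (mC m) = gC (idet m).
Proof.
case: m => [[a b] c].
by rewrite det3 !mxE /= /idet !(gC_add, gC_opp, gC_mul); ring.
Qed.

Lemma gaussIntP (z : C) : reflect (exists x, z = gC x) (gaussInt z).
Proof.
apply: (iffP andP) => [[/intrP[a ea] /intrP[b eb]]|[[a b] ->]].
  by exists (a, b); apply/eqP; rewrite eq_complex /= ea eb !eqxx.
by split; apply/intrP; [exists a | exists b].
Qed.

Lemma gaussInt0 : gaussInt (0 : C). Proof. by apply/gaussIntP; exists (0, 0). Qed.
Lemma gaussInt1 : gaussInt (1 : C). Proof. by apply/gaussIntP; exists (1, 0). Qed.
Lemma gaussIntD (x y : C) : gaussInt x -> gaussInt y -> gaussInt (x + y).
Proof.
by move=> /gaussIntP[a ->] /gaussIntP[b ->]; apply/gaussIntP; exists (gadd a b); rewrite gC_add.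
Qed.
Lemma gaussIntM (x y : C) : gaussInt x -> gaussInt y -> gaussInt (x * y).
Proof.
by move=> /gaussIntP[a ->] /gaussIntP[b ->]; apply/gaussIntP; exists (gmul a b); rewrite gC_mul.
Qed.
Lemma gaussInt_conj (x : C) : gaussInt x -> gaussInt x^*.
Proof. by move=> /gaussIntP[a ->]; apply/gaussIntP; exists (gconj a); rewrite gC_conj. Qed.
Lemma gaussInt_sum (I : Type) (r : seq I) (P : pred I) (f : I -> C) :
  (forall i, gaussInt (f i)) -> gaussInt (\sum_(i <- r | P i) f i).
Proof.
move=> fi; apply: (big_ind (fun z => gaussInt z : Prop)) => //; first exact: gaussInt0.
exact: gaussIntD.
Qed.

Lemma gaussInt_mulmx (m n p : nat) (A : 'M[C]_(m, n)) (B : 'M[C]_(n, p)) :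
  (forall i j, gaussInt (A i j)) -> (forall i j, gaussInt (B i j)) ->
  forall i j, gaussInt ((A *m B) i j).
Proof. by move=> ha hb i j; rewrite mxE; apply: gaussInt_sum => k; apply: gaussIntM. Qed.

Lemma gaussInt_vC (v : 'cV[C]_3) : (forall i, gaussInt (v i 0)) -> exists x, v = vC x.
Proof.
move=> hv; have /gaussIntP[a ea] := hv 0; have /gaussIntP[b eb] := hv 1.
have /gaussIntP[c ec] := hv 2.
by exists (a, b, c); rewrite -[v]vec3_id ea eb ec.
Qed.

Lemma vC_gaussInt x i : gaussInt (vC x i 0).
Proof. by case: (ord3_cases i) => ->; rewrite vec3E; apply/gaussIntP; eexists. Qed.

Lemma mC_gaussInt m i j : gaussInt (mC m i j).
Proof.
by case: m => [[a b] c]; rewrite mxE; case: (ord3_cases j) => -> /=; apply: vC_gaussInt.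
Qed.

Lemma Gamma_mC m : iGamma m -> Gamma (mC m).
Proof.
case: m => [[a b] c] /and5P[/eqP aa /eqP ab /eqP ac /eqP ba].
move=> /and5P[/eqP bb /eqP bc /eqP ca /eqP cb /andP[/eqP cc /eqP d1]].
split; last exact: mC_gaussInt.
split; first by rewrite det_mC d1 gC1.
have E (u v : ivec) : hermQ (vC u) (vC v) = gC (iQ u v) := iQP u v.
have G i j : ((mC (a, b, c)) ^t* *m Hmx R *m mC (a, b, c)) i j
    = hermQ (nth 0 [:: vC a; vC b; vC c] i) (nth 0 [:: vC a; vC b; vC c] j).
  by rewrite /hermQ !mxE; apply: eq_bigr => k _; rewrite !mxE /=; congr (_ * _);
     apply: eq_bigr => l _; rewrite !mxE.
apply: M3_eq => j; rewrite G; case: (ord3_cases j) => -> /=;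
  rewrite E ?(aa, ab, ac, ba, bb, bc, ca, cb, cc) mxE /= ?gCi ?gC0 ?gCN1 ?gCNi //.
Qed.

End IntegralModel.

(** * The group Gamma and its parabolic subgroups *)

Section Parabolics.
Variable R : realType.
Local Notation C := R[i].
Implicit Types (g : 'M[C]_3) (u v w : 'cV[C]_3).

Lemma Gamma_SU21 g : Gamma g -> SU21 g. Proof. by case. Qed.

Lemma Gamma_1 : Gamma (1%:M : 'M[C]_3).
Proof.
split; first exact: SU21_1.
by move=> i j; rewrite mxE; case: (i == j); [exact: gaussInt1 | exact: gaussInt0].
Qed.

Lemma Gamma_mul g h : Gamma g -> Gamma h -> Gamma (g *m h).
Proof.
move=> [Sg ig] [Sh ih]; split; first exact: SU21_mul.
exact: gaussInt_mulmx.
Qed.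

Lemma gaussInt_i : gaussInt ('i : C).
Proof. by apply/gaussIntP; exists (0, 1); rewrite gCi. Qed.

Lemma gaussIntN (x : C) : gaussInt x -> gaussInt (- x).
Proof. by move=> /gaussIntP[a ->]; apply/gaussIntP; exists (gopp a); rewrite gC_opp. Qed.

Lemma Hmx_gaussInt i j : gaussInt (Hmx R i j).
Proof.
have i0 := gaussInt0 R; have iN := gaussIntN (gaussInt1 R).
have iI := gaussInt_i; have iJ := gaussIntN gaussInt_i.
by rewrite mxE; case: (ord3_cases i) => ->; case: (ord3_cases j) => ->.
Qed.

Lemma Gamma_inv g : Gamma g -> Gamma (invmx g).
Proof.
move=> [Sg ig]; split; first exact: SU21_invmx.
rewrite SU21_inv //; apply: gaussInt_mulmx => [|]; last exact: Hmx_gaussInt.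
apply: gaussInt_mulmx => [|i j]; first exact: Hmx_gaussInt.
by rewrite !mxE; apply: gaussInt_conj.
Qed.

Lemma Gamma_K g v : Gamma g -> invmx g *m (g *m v) = v.
Proof. by move=> [Sg _]; rewrite mulKmx // SU21_unit. Qed.

Lemma Gamma_KV g v : Gamma g -> g *m (invmx g *m v) = v.
Proof. by move=> [Sg _]; rewrite mulKVmx // SU21_unit. Qed.

Lemma reduced_isotropic_act g v :
  Gamma g -> reduced_isotropic v -> reduced_isotropic (g *m v).
Proof.
move=> Gg [iv Qv [w [iw wv]]]; have [Sg ig] := Gg; split.
- by move=> i; apply: gaussInt_mulmx => // k l; rewrite (ord1 l).
- by rewrite SU21_hermQ.
have sE (x y : 'cV[C]_3) : \sum_i x i 0 * y i 0 = (x^T *m y) 0 0.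
  by rewrite !mxE; apply: eq_bigr => i _; rewrite mxE.
(* The coefficients of a Bezout relation transform by the inverse transpose. *)
exists ((invmx g)^T *m w); split.
  move=> i; apply: gaussInt_mulmx => [k l|k l]; last by rewrite (ord1 l).
  by rewrite mxE; case: (Gamma_inv Gg).
by rewrite sE trmx_mul trmxK -mulmxA Gamma_K // -sE.
Qed.

Definition gunit (c : C) : Prop := gaussInt c /\ nsq c = 1.

Lemma gunit1 : gunit 1. Proof. by split; [exact: gaussInt1 | exact: nsq1]. Qed.

Lemma gunit_mul (c d : C) : gunit c -> gunit d -> gunit (c * d).
Proof. by move=> [ic c1] [id d1]; split; [exact: gaussIntM | rewrite nsqM c1 d1 mulr1]. Qed.

Lemma gunit_inv (c : C) : gunit c -> gunit c^* /\ c^* * c = 1.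
Proof.
by move=> [ic c1]; split; [split; [exact: gaussInt_conj | rewrite nsq_conj] | rewrite nsqE c1].
Qed.

Lemma reduced_isotropic_unit (c : C) v :
  gunit c -> reduced_isotropic v -> reduced_isotropic (c *: v).
Proof.
move=> uc [iv Qv [w [iw wv]]]; have [[ic' _] cc] := gunit_inv uc; have [ic c1] := uc.
split.
- by move=> i; rewrite mxE; apply: gaussIntM.
- by rewrite hermQZl hermQZr Qv !mulr0.
exists (c^* *: w); split; first by move=> i; rewrite mxE; apply: gaussIntM.
rewrite -[RHS]wv; apply: eq_bigr => i _; rewrite !mxE.
by rewrite mulrACA cc mul1r.
Qed.

Lemma reduced_isotropic_neq0 v : reduced_isotropic v -> v != 0.
Proof.
case=> _ _ [w [_ wv]]; apply/eqP => v0; move: wv.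
rewrite big1 => [/esym/eqP|i _]; first by rewrite oner_eq0.
by rewrite v0 mxE mulr0.
Qed.

Lemma int_mul_eq1 (n m : int) : 0 <= n -> 0 <= m -> n * m = 1 -> n = 1.
Proof.
move=> n0 m0 e.
have m1 : 1 <= m by case: (ltP 0 m) => [|m']; [lia | have := e; rewrite (_ : m = 0); lia].
have n1 : 1 <= n by case: (ltP 0 n) => [|n']; [lia | have := e; rewrite (_ : n = 0); lia].
nia.
Qed.

Lemma inorm_ge0 (x : gint) : 0 <= inorm x.
Proof. rewrite /inorm; nia. Qed.

(** Bezout coefficients of v, applied to v', give c; those of v', applied to v, give its inverse.
    Both are thus Gaussian integers, and their norms multiply to 1. *)
Lemma reduced_isotropic_prop v v' (c : C) :
  reduced_isotropic v -> reduced_isotropic v' -> v' = c *: v -> gunit c.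
Proof.
move=> [iv Qv [w [iw wv]]] [iv' Qv' [w' [iw' wv']]] E.
have lin (x : 'cV[C]_3) : \sum_i x i 0 * v' i 0 = c * \sum_i x i 0 * v i 0.
  by rewrite E mulr_sumr; apply: eq_bigr => i _; rewrite mxE mulrCA.
have ic : gaussInt c.
  have -> : c = \sum_i w i 0 * v' i 0 by rewrite lin wv mulr1.
  by apply: gaussInt_sum => i; apply: gaussIntM.
have id : gaussInt (\sum_i w' i 0 * v i 0) by apply: gaussInt_sum => i; apply: gaussIntM.
have cd := esym (lin w'); rewrite wv' in cd.
split=> //; have := congr1 (@nsq R) cd; rewrite nsqM nsq1.
case/gaussIntP: ic => a ->; case/gaussIntP: id => b ->; rewrite !nsq_gC -intrM.
rewrite -[1]/(1%:~R) => /eqP; rewrite eqr_int => /eqP e.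
by rewrite (@int_mul_eq1 (inorm a) (inorm b)) // inorm_ge0.
Qed.

Lemma line_stab_scale (c : C) v : c != 0 -> line_stab (c *: v) = line_stab v.
Proof.
move=> c0; apply/seteqP; split => g [Sg [d e]]; split=> //; exists d.
  by apply: (scalerI c0); rewrite scalemxAr e !scalerA mulrC.
by rewrite -scalemxAr e !scalerA mulrC.
Qed.

Lemma gunit_neq0 (c : C) : gunit c -> c != 0.
Proof. by move=> [_ c1]; rewrite -nsq_eq0 c1 oner_eq0. Qed.

Lemma conjP_line_stab g v : SU21 g -> conjP g (line_stab v) = line_stab (g *m v).
Proof.
move=> Sg; have Ug := SU21_unit Sg; apply/seteqP; split => h.
  move=> [k [Sk [c e]] <-]; split.
    by apply: SU21_mul; [apply: SU21_mul | apply: SU21_invmx].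
  by exists c; rewrite -!mulmxA mulKmx // e scalemxAr.
move=> [Sh [c e]]; exists (invmx g *m h *m g).
  split; first by do ![apply: SU21_mul => //]; apply: SU21_invmx.
  by exists c; rewrite -!mulmxA e -scalemxAr mulKmx.
by rewrite -!mulmxA mulmxV // mulmx1 mulKVmx.
Qed.

End Parabolics.

(** * Cusps *)

(* With b = (m + n) + (m - n) i, the unipotent element of the stabiliser of the
   cusp (1, 0, 0) that translates the middle coordinate by b; as m and n vary, b
   runs over (1 + i) Z[i]. *)
Definition itrans (m n r : int) : imat :=
  (ie1, ((m - n, m + n), (1, 0), (0, 0)),
   ((r, m * m + n * n), (m + n, m - n), (1, 0))).

(** The Weyl element that exchanges the cusps (1, 0, 0) and (0, 0, 1); the sign is forced by the
    form. *)
Definition iswap : imat := ((0, 0, (0, 0), (-1, 0)), ie2, ie1).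

Lemma iGamma_trans m n r : iGamma (itrans m n r).
Proof.
do ?[apply/andP; split]; apply/eqP => /=; ring.
Qed.

Lemma iGamma_swap : iGamma iswap. Proof. by vm_compute. Qed.

Section Cusps.
Variable R : realType.
Local Notation C := R[i].
Implicit Types (g : 'M[C]_3) (u v w : 'cV[C]_3).

Lemma round_half (x : R) : exists k : int, -(1/2) <= x + k%:~R <= 1/2.
Proof.
have := Num.Theory.floor_itv (x + 1/2) => /andP[].
set k := Num.floor _; rewrite intrD => h1 h2; exists (- k); rewrite intrN.
by apply/andP; split; lra.
Qed.

Lemma diamond_sq (x y : R) : `|x| + `|y| <= 1 -> x ^+ 2 + y ^+ 2 <= 1.
Proof.
rewrite -(real_normK (num_real x)) -(real_normK (num_real y)) => h.
have h1 := normr_ge0 x; have h2 := normr_ge0 y; nra.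
Qed.

Lemma mulmx_vec3 g (a b c : C) : g *m vec3 a b c =
  vec3 (g 0 0 * a + g 0 1 * b + g 0 2 * c) (g 1 0 * a + g 1 1 * b + g 1 2 * c)
       (g 2 0 * a + g 2 1 * b + g 2 2 * c).
Proof. by apply: cV3_eq; rewrite !mxE sum3 !mxE. Qed.

Lemma trans_vec3 m n r (w1 w2 w3 : C) :
  mC R (itrans m n r) *m vec3 w1 w2 w3 =
  vec3 (w1 + gC R (m - n, m + n) * w2 + gC R (r, m * m + n * n) * w3)
       (w2 + gC R (m + n, m - n) * w3) w3.
Proof.
rewrite mulmx_vec3 !mxE /= !gC1 !gC0.
by congr vec3; rewrite ?mul1r ?mul0r ?add0r ?addr0.
Qed.

Lemma swap_vec3 (w1 w2 w3 : C) :
  mC R iswap *m vec3 w1 w2 w3 = vec3 w3 w2 (- w1).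
Proof.
rewrite mulmx_vec3 !mxE /= !gC1 !gC0 gCN1.
by congr vec3; rewrite ?mul1r ?mul0r ?add0r ?addr0 // mulN1r.
Qed.

(** The middle translations form (1 + i) Z[i], which has the diamond |x| + |y| <= 1 as a cell: it is
    reached by rounding (x + y) / 2 and (x - y) / 2. The integer r comes last, because the middle
    translation also moves the first coordinate; this leaves the shear e free. Both c and e are 0 in
    the Euclidean algorithm and 1 around the hole of the height estimate. *)
Lemma translate (c e : R) (z1 z2 : C) : exists m n r (w1 w2 : C),
  [/\ mC R (itrans m n r) *m vec3 z1 z2 1 = vec3 w1 w2 1,
      `|complex.Re w2 - c| + `|complex.Im w2| <= 1 &
      `|complex.Re w1 + e * complex.Im w2| <= 1/2].
Proof.
case: z1 z2 => [x1 y1] [x2 y2].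
have [m /andP[m1 m2]] := round_half ((x2 - c + y2) / 2).
have [n /andP[n1 n2]] := round_half ((x2 - c - y2) / 2).
set s := x2 + (m + n)%:~R; set t := y2 + (m - n)%:~R.
have [r /andP[r1 r2]] := round_half (x1 + (m - n)%:~R * x2 - (m + n)%:~R * y2 + e * t).
exists m, n, r; do 2 eexists; split; first exact: trans_vec3.
  rewrite /= !(mulr1, mulr0, subr0); move: m1 m2 n1 n2.
  rewrite intrB intrD => m1 m2 n1 n2.
  case: (ger0P (x2 + _ - c)) => ?; case: (ger0P (y2 + _)) => ?; lra.
rewrite ler_norml /= !(mulr1, mulr0, subr0, addr0); apply/andP; split.
  by move: r1; rewrite /t; lra.
by move: r2; rewrite /t; lra.
Qed.

Definition e1 : 'cV[C]_3 := vec3 1 0 0.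
Definition e3 : 'cV[C]_3 := vec3 0 0 1.

Lemma vC_ie1 : vC R ie1 = e1. Proof. by rewrite /vC /= gC0 gC1. Qed.
Lemma vC_ie3 : vC R ie3 = e3. Proof. by rewrite /vC /= gC0 gC1. Qed.

Lemma reduced_isotropic_e1 : reduced_isotropic e1.
Proof.
split; first by move=> i; rewrite -vC_ie1; apply: vC_gaussInt.
  by rewrite hermQ_vec3 rmorph0; ring.
exists e1; split; first by move=> i; rewrite -vC_ie1; apply: vC_gaussInt.
by rewrite sum3 !vec3E; ring.
Qed.

Lemma hermQ_e1 v : hermQ e1 v = 'i * v 2 0.
Proof. by rewrite hermQE !vec3E rmorph1 rmorph0; ring. Qed.

Lemma isotropic_q0 v : hermQ v v = 0 -> v 2 0 = 0 -> v = v 0 0 *: e1.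
Proof.
rewrite hermQE => e q0; move: e; rewrite q0 rmorph0 !(mulr0, mul0r, subr0, sub0r) => /eqP.
rewrite oppr_eq0 nsqE => /eqP[] /eqP; rewrite nsq_eq0 => /eqP p0.
by apply: cV3_eq; rewrite !mxE /= ?mulr1 ?mulr0 ?p0 ?q0.
Qed.

Lemma isotropic_vec3 (a b c : C) : hermQ (vec3 a b c) (vec3 a b c) = 0 ->
  2 * (complex.Im a * complex.Re c - complex.Re a * complex.Im c) = nsq b.
Proof.
rewrite hermQ_vec3 iE /nsq; case: a b c => [a a'] [b b'] [c c'] [] /= e _.
by lra.
Qed.

Lemma nsqN (x : C) : nsq (- x) = nsq x.
Proof. by case: x => a b; rewrite /nsq /= !sqrrN. Qed.

Lemma nsq_i : nsq ('i : C) = 1.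
Proof. by rewrite iE /nsq /= expr0n expr1n add0r. Qed.

(* A Euclidean algorithm: after a translation the vector is q (z1, z2, 1) with
   |z2| <= 1, |Re z1| <= 1/2 and, being isotropic, 2 Im z1 = |z2|^2; hence
   |z1|^2 <= 1/2 and exchanging the outer coordinates decreases |q|. *)
Lemma cusp_transitive v : reduced_isotropic v ->
  exists2 g, Gamma g & exists2 c, gunit c & g *m v = c *: e1.
Proof.
have main k : forall v, reduced_isotropic v -> nsq (v 2 0) < k%:R ->
    exists2 g, Gamma g & exists2 c, gunit c & g *m v = c *: e1.
  elim: k => [|k IH] {}v riv; first by rewrite ltNge nsq_ge0.
  have [iv Qv _] := riv; have [q0|q0] := eqVneq (v 2 0) 0.
    move=> _; exists 1%:M; first exact: Gamma_1.
    have E := isotropic_q0 Qv q0; exists (v 0 0); last by rewrite mul1mx.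
    exact: reduced_isotropic_prop reduced_isotropic_e1 riv E.
  move=> vk; set q := v 2 0.
  have [m [n [r [w1 [w2 [E]]]]]] := translate 0 0 (v 0 0 / q) (v 1 0 / q).
  rewrite subr0 mul0r addr0 => h1 h2.
  have Ev : v = q *: vec3 (v 0 0 / q) (v 1 0 / q) 1.
    by apply: cV3_eq; rewrite !mxE /= ?mulr1 // mulrC divfK.
  have Gt : Gamma (mC R iswap *m mC R (itrans m n r)).
    by apply: Gamma_mul; apply: Gamma_mC; [exact: iGamma_swap | exact: iGamma_trans].
  set v' := mC R iswap *m mC R (itrans m n r) *m v.
  have Ev' : v' = q *: vec3 1 w2 (- w1).
    by rewrite /v' {1}Ev -scalemxAr -mulmxA E swap_vec3.
  have riv' : reduced_isotropic v' by apply: reduced_isotropic_act.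
  have Qw : hermQ (vec3 1 w2 (- w1)) (vec3 1 w2 (- w1)) = 0.
    have [_ + _] := riv'; rewrite Ev' hermQZl hermQZr mulrA nsqE => /eqP.
    by rewrite mulf_eq0 => /orP[/eqP[] /eqP|/eqP//]; rewrite nsq_eq0 (negPf q0).
  have w1_le : nsq w1 <= 1/2.
    have := isotropic_vec3 Qw; case: w1 w2 h1 h2 {E Ev' Qw} => [a a'] [b b'] /= h1.
    rewrite /nsq /= ler_norml => /andP[a1 a2] e.
    have := diamond_sq h1.
    by nra.
  have [|g Gg [c uc e]] := IH v' riv'.
    have qw : nsq q * nsq w1 = nsq (v' 2 0) by rewrite Ev' mxE vec3E nsqM nsqN.
    have qw' : nsq q * nsq w1 < nsq q by have : 0 < nsq q; [rewrite nsq_gt0 | nra].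
    move: vk qw'; rewrite qw -/q; have /gaussIntP[y ->] : gaussInt q by exact: iv.
    have /gaussIntP[y' ->] : gaussInt (v' 2 0) by case: riv'.
    rewrite !nsq_gC -[k.+1%:R]/((k.+1%:Z)%:~R) -[k%:R]/((k%:Z)%:~R) !ltr_int; lia.
  exists (g *m (mC R iswap *m mC R (itrans m n r))); first exact: Gamma_mul.
  by exists c; rewrite // -mulmxA.
move=> riv; have := archi_boundP (nsq_ge0 (v 2 0)); exact: main riv.
Qed.

(** With N = |a|^2 and T the real part, N Q <= 2 T and T^2 <= N |x|^2 |y|^2; square and cancel one
    factor N. *)
Lemma gram_bound (a x y : C) (Q d : R) : 0 <= d -> 0 <= Q ->
  nsq a * Q + d = 2 * complex.Re (a * y * x^*) -> nsq a * Q ^+ 2 <= 4 * nsq x * nsq y.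
Proof.
move=> d0 Q0; set T := complex.Re _ => E.
have TN : T ^+ 2 <= nsq a * (nsq x * nsq y).
  rewrite (_ : _ * _ = nsq (a * y * x^*)) ?/nsq -/T ?lerDl ?sqr_ge0 //.
  by rewrite -[RHS]/(nsq _) !nsqM nsq_conj mulrAC mulrA.
have N0 := nsq_ge0 a; move: (nsq a) (nsq x) (nsq y) N0 (nsq_ge0 x) (nsq_ge0 y) E TN => N X Y *.
have [->|Nn] := eqVneq N 0; first by rewrite mul0r !mulr_ge0.
have Np : 0 < N by rewrite lt_def Nn.
have NT : (N * Q) ^+ 2 <= (2 * T) ^+ 2.
  have : 0 <= N * Q by rewrite mulr_ge0.
  have : N * Q <= 2 * T by lra.
  nra.
rewrite -(ler_pM2l Np); lra.
Qed.

(* The Gram matrix of (v, v', w) has determinant |det(v, v', w)|^2 det H >= 0. *)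
Lemma pair_bound v v' w : hermQ v v = 0 -> hermQ v' v' = 0 -> 0 < Qre w ->
  nsq (hermQ v v') * Qre w ^+ 2 <= 4 * absQ2 v w * absQ2 v' w.
Proof.
move=> Qv Qv' Qw.
pose A : 'M[C]_3 := \matrix_(i, j) (nth 0 [:: v; v'; w] j) i 0.
pose G := A ^t* *m Hmx R *m A.
have GE i j : G i j = hermQ (nth 0 [:: v; v'; w] i) (nth 0 [:: v; v'; w] j).
  by rewrite /hermQ !mxE; apply: eq_bigr => k _; rewrite !mxE /=; congr (_ * _);
     apply: eq_bigr => l _; rewrite !mxE.
have detH : \det (Hmx R) = 1.
  by rewrite det3 !mxE /= !(mul0r, mulr0, subr0, sub0r, addr0, add0r);
     rewrite iE; apply/eqP; rewrite eq_complex /=; apply/andP; split; apply/eqP; ring.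
have dG : \det G = (nsq (\det A))%:C%C.
  by rewrite !det_mulmx detH mulr1 det_map_mx det_tr nsqE.
(* The left side is the expanded Gram determinant, with a = Q(v, v'), x = Q(v, w), y = Q(v', w); the
   zeros come from isotropy. *)
have key (a x y : C) (Q d : R) :
    0 * (0 * Q%:C%C - y^* * y) - a^* * (a * Q%:C%C - y^* * x) + x^* * (a * y - 0 * x) = d%:C%C ->
    nsq a * Q + d = 2 * complex.Re (a * y * x^*).
  case: a x y => [a a'] [x x'] [y y'] [] <- _; rewrite /nsq /=; ring.
apply: (gram_bound (nsq_ge0 (\det A)) (ltW Qw)); apply: key.
by rewrite -dG (det3 G) !GE /= Qv Qv' hermQ_self !hermQC.
Qed.

End Cusps.

(** * Minimal vectors and the height estimate *)

Section Minimal.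
Variable R : realType.
Local Notation C := R[i].
Implicit Types (g : 'M[C]_3) (u v w : 'cV[C]_3).

Definition minvec w v : Prop :=
  reduced_isotropic v /\ forall u, reduced_isotropic u -> absQ2 v w <= absQ2 u w.

Lemma minvec_act g w v : Gamma g -> minvec w v -> minvec (g *m w) (g *m v).
Proof.
move=> Gg [rv mv]; have Sg := Gamma_SU21 Gg; split; first exact: reduced_isotropic_act.
move=> u ru; rewrite (absQ2_act v w Sg) -(Gamma_KV u Gg) (absQ2_act _ w Sg); apply: mv.
by apply: reduced_isotropic_act ru; apply: Gamma_inv.
Qed.

Lemma minvec_actE g w v : Gamma g -> minvec (g *m w) v <-> minvec w (invmx g *m v).
Proof.
move=> Gg; split => [/(minvec_act (Gamma_inv Gg))|/(minvec_act Gg)].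
  by rewrite (Gamma_K w Gg).
by rewrite (Gamma_KV v Gg).
Qed.

Lemma minvecZ (c : C) w v : c != 0 -> minvec (c *: w) v <-> minvec w v.
Proof.
rewrite -(nsq_gt0 c) => c0; split=> -[rv mv]; (split; first exact: rv) => u ru.
  by have := mv u ru; rewrite !absQ2_Zr (ler_pM2l c0).
by rewrite !absQ2_Zr (ler_pM2l c0); apply: mv.
Qed.

Lemma minvec_unit (c : C) w v : gunit c -> minvec w (c *: v) <-> minvec w v.
Proof.
have half d u : gunit d -> minvec w u -> minvec w (d *: u).
  move=> ud [ru mu]; split; first exact: reduced_isotropic_unit.
  by rewrite absQ2_Zl; [|case: ud].
move=> uc; split=> [m|]; last exact: half.
have [uc' cc] := gunit_inv uc.
by rewrite -[v]scale1r -cc -scalerA; apply: half.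
Qed.

Lemma minvec_F w u v : minvec w u -> minvec w v -> absQ2 u w = absQ2 v w.
Proof. by move=> [ru mu] [rv mv]; apply/le_anti/andP; split; [apply: mu | apply: mv]. Qed.

Lemma absQ2_coords (v : ivec) (x y a b : R) :
  absQ2 (vC R v) (vec3 (x +i* y)%C (a +i* b)%C 1) =
  let n1 := v.1.1.1%:~R in let n2 := v.1.1.2%:~R in
  let p1 := v.1.2.1%:~R in let p2 := v.1.2.2%:~R in
  let q1 := v.2.1%:~R in let q2 := v.2.2%:~R in
  (n2 - p1 * a - p2 * b + q1 * y - q2 * x) ^+ 2 +
  (n1 - p1 * b + p2 * a - q1 * x - q2 * y) ^+ 2.
Proof.
case: v => [[[n1 n2] [p1 p2]] [q1 q2]].
by rewrite /absQ2 hermQ_vec3 iE /nsq /gC /=; congr (_ ^+ 2 + _ ^+ 2); ring.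
Qed.

Lemma Qre_coords (x y a b : R) :
  Qre (vec3 (x +i* y)%C (a +i* b)%C 1) = 2 * y - a ^+ 2 - b ^+ 2.
Proof. by rewrite /Qre hermQ_vec3 iE /=; ring. Qed.

Lemma absQ2_e1 (z1 z2 z3 : C) : absQ2 (e1 R) (vec3 z1 z2 z3) = nsq z3.
Proof. by rewrite /absQ2 hermQ_e1 vec3E nsqM nsq_i mul1r. Qed.

Lemma gunit_gC (x : gint) : inorm x = 1 -> gunit (gC R x).
Proof. by move=> x1; split; [apply/gaussIntP; exists x | rewrite nsq_gC x1]. Qed.

(** A coordinate of norm 1 is inverted by its conjugate, which yields the Bezout relation. All
    vectors on the list have such a coordinate. *)
Lemma reduced_isotropic_vC (v : ivec) : iQ v v = (0, 0) ->
  [|| inorm v.1.1 == 1, inorm v.1.2 == 1 | inorm v.2 == 1] -> reduced_isotropic (vC R v).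
Proof.
move=> Qv hv; split; [exact: vC_gaussInt | by rewrite iQP Qv gC0 |].
have [i /andP[iv /eqP vi]] : exists i, (gaussInt (vC R v i 0)) && (nsq (vC R v i 0) == 1).
  by case/or3P: hv => /eqP e; [exists 0 | exists 1 | exists 2];
     rewrite vC_gaussInt /= vec3E nsq_gC e.
exists (\col_j if j == i then (vC R v i 0)^* else 0); split.
  move=> j; rewrite mxE; case: eqP => _; [exact: gaussInt_conj | exact: gaussInt0].
rewrite (bigD1 i) //= mxE eqxx nsqE vi big1 ?addr0 // => j /negPf ji.
by rewrite mxE ji mul0r.
Qed.

(** * Elementary inequalities for the height estimate *)

Lemma ler_sq (x y : R) : 0 <= x -> x <= y -> x ^+ 2 <= y ^+ 2.
Proof. nra. Qed.

Lemma ler_sq_abs (x y : R) : - y <= x -> x <= y -> x ^+ 2 <= y ^+ 2.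
Proof. nra. Qed.

(** A bootstrap: 866/1000 lies just below sqrt(3) / 2, so s - o / 2 <= 134/1000, and each bound s <=
    c turns o <= 2 s^2 into o <= 2 c s, which improves the bound on s. Three rounds give 268, 184
    and 165 thousandths. *)
Lemma covering_step1 (s o : R) : 0 <= s -> s <= 1 -> 0 <= o -> o <= s -> o <= 2 * s * s ->
  3/4 <= (1 - s + o / 2) ^+ 2 -> s <= 165/1000 /\ o <= s / 3.
Proof.
move=> s0 s1 o0 os o2 a34.
have a866 : 866/1000 <= 1 - s + o / 2.
  by rewrite leNgt; apply/negP => al; have := @ler_sq (1 - s + o / 2) (866/1000); lra.
clear a34.
have step c : 0 <= c -> s <= c -> o <= 2 * c * s.
  by move=> c0 sc; apply: (le_trans o2); rewrite ler_wpM2r // ler_pM2l.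
have sa : s <= 268/1000 by lra.
have ea := @step (268/1000) ltac:(lra) sa.
have sb : s <= 184/1000 by clear step o2; lra.
have eb := @step (184/1000) ltac:(lra) sb.
have sc : s <= 165/1000 by clear step o2; lra.
have ec := @step (165/1000) ltac:(lra) sc.
by clear step o2; split; lra.
Qed.

(** For p > 0, the bounds p^2 <= p / 2 and o^2 <= 55/1000 o make the hypothesis linear in p and
    o. *)
Lemma covering_step2 (o p : R) : 0 <= o -> o <= 55/1000 -> p <= 1/2 ->
  1 <= 2 * ((1/2 + o / 2) ^+ 2 + (p - 1/2) ^+ 2) -> p <= 106/100 * o.
Proof.
move=> o0 o1 p1 H.
have oo : o ^+ 2 <= 55/1000 * o by rewrite expr2 ler_wpM2r.
have [|p0] := lerP p 0; first by lra.
have pp : p ^+ 2 <= 1/2 * p by rewrite expr2 ler_wpM2r // ltW.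
lra.
Qed.

(** The hypotheses give 1 <= (1 - 5/6 s)^2 + (136/100 s)^2, where for small s the negative linear
    term outweighs the quadratic ones. *)
Lemma covering_step3 (s t p a : R) : 0 <= s -> s <= 165/1000 -> - s <= t -> t <= s ->
  - (36/100 * s) <= p -> p <= 36/100 * s -> 0 <= a -> a <= 1 - 5/6 * s ->
  1 <= a ^+ 2 + (p + t) ^+ 2 -> s = 0.
Proof.
move=> s0 s1 t1 t2 p1 p2 a0 a1 A.
have pt : (p + t) ^+ 2 <= (136/100 * s) ^+ 2 by apply: ler_sq_abs; lra.
have aa := ler_sq a0 a1.
have {A pt aa} : 1 <= (1 - 5/6 * s) ^+ 2 + (136/100 * s) ^+ 2.
  exact: (le_trans A (lerD aa pt)).
have ss : s ^+ 2 <= 165/1000 * s by rewrite expr2 ler_wpM2r.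
lra.
Qed.

(** Here F is 1 at the cusp (1, 0, 0), (s, t) is the horizontal displacement from the hole towards
    the nearest of four cusps at distance 1, and p is the vertical one. The hypotheses indexed by k
    say that this cusp and its vertical translates do not beat (1, 0, 0); the last two say it of the
    cusps of denominator 1 + i above the hole. The former make s small, the latter then bound |p| by
    a multiple of s^2 + t^2, and the former with k = 0 leave only s = 0. *)
Lemma covering_core (s t p h : R) : `|t| <= s -> s + `|t| <= 1 -> `|p| <= 1/2 ->
  0 < h <= 1/2 ->
  (forall k : R, k \in [:: -1; 0; 1] ->
     1 <= (h + ((1 - s) ^+ 2 + t ^+ 2) / 2) ^+ 2 + (p + t + k) ^+ 2) ->
  1 <= 2 * ((h + (s ^+ 2 + t ^+ 2) / 2) ^+ 2 + (p + 1/2) ^+ 2) ->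
  1 <= 2 * ((h + (s ^+ 2 + t ^+ 2) / 2) ^+ 2 + (p - 1/2) ^+ 2) ->
  [/\ s = 0, t = 0, p = 0 & h = 1/2].
Proof.
rewrite !ler_norml => /andP[t1 t2] st /andP[p1 p2] /andP[h0 h1] A Bp Bm.
have {st} [st1 st2] : s + t <= 1 /\ s - t <= 1.
  by move: st; clear; case: (ger0P t) => ? ?; split; lra.
have s0 : 0 <= s by clear A Bp Bm; lra.
have := A 0; have := A (-1); have := A 1; rewrite !inE !eqxx !orbT /=.
move=> /(_ isT) A1 /(_ isT) A2 /(_ isT) A0 {A}.
set o := s ^+ 2 + t ^+ 2 in Bp Bm *.
have o0 : 0 <= o by rewrite addr_ge0 ?sqr_ge0.
have tt : t ^+ 2 <= s ^+ 2 by apply: ler_sq_abs.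
have o2 : o <= 2 * s * s by rewrite /o; clear - tt; lra.
have o1 : o <= s by rewrite /o; clear - s0 st1 st2 t1 t2; nra.
set a := 1 - s + o / 2.
set b := (h + _) ^+ 2 in A0 A1 A2.
have ha : b <= a ^+ 2.
  apply: ler_sq; last by rewrite /a /o; clear - h1; lra.
  by have := sqr_ge0 (1 - s); have := sqr_ge0 t; clear - h0; lra.
have hb : (h + o / 2) ^+ 2 <= (1/2 + o / 2) ^+ 2.
  by apply: ler_sq; clear - h0 h1 o0; lra.
have sq4 (x : R) : - (1/2) <= x -> x <= 1/2 -> x ^+ 2 <= 1/4.
  by move=> x1 x2; apply: le_trans (ler_sq_abs x1 x2) _; lra.
(* One of the three k brings p + t + k into [-1/2, 1/2]. *)
have a34 : 3/4 <= a ^+ 2.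
  have [k1|k1] := lerP (p + t) (1/2); last first.
    have := @sq4 (p + t - 1) ltac:(clear - k1; lra) ltac:(clear - p2 t2 st1 st2 t1; lra).
    by move: ((p + t - 1) ^+ 2) A2; clear - ha; move=> ? ? ?; lra.
  have [k2|k2] := lerP (-(1/2)) (p + t).
    have := @sq4 (p + t + 0) ltac:(clear - k2; lra) ltac:(clear - k1; lra).
    by move: ((p + t + 0) ^+ 2) A0; clear - ha; move=> ? ? ?; lra.
  have := @sq4 (p + t + 1) ltac:(clear - p1 t2 st1 st2 t1; lra) ltac:(clear - k2; lra).
  by move: ((p + t + 1) ^+ 2) A1; clear - ha; move=> ? ? ?; lra.
have [s1 o3] := covering_step1 s0 ltac:(clear - st1 st2; lra) o0 o1 o2 a34.
have o4 : o <= 55/1000 by clear - s1 o3; lra.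
have pp : p <= 106/100 * o.
  apply: (covering_step2 o0 o4 p2); apply: (le_trans Bm).
  by rewrite ler_pM2l // lerD2r.
have pm : - p <= 106/100 * o.
  apply: (covering_step2 o0 o4); first by clear - p1; lra.
  apply: (le_trans Bp); rewrite ler_pM2l // (_ : - p - 1/2 = - (p + 1/2)); last by clear; lra.
  by rewrite sqrrN lerD2r.
have s00 : s = 0.
  apply: (@covering_step3 s t p a) => //.
  - by clear - pm o3 s0; lra.
  - by clear - pp o3 s0; lra.
  - by rewrite /a; clear - st1 st2 o0; lra.
  - by rewrite /a; clear - o3 s0; lra.
  by move: A0; rewrite addr0 => A0; apply: (le_trans A0); rewrite lerD2r.
have t00 : t = 0 by clear - t1 t2 s00; lra.
have o00 : o = 0 by rewrite /o s00 t00; clear; lra.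
have p00 : p = 0 by clear - pp pm o00; lra.
split=> //; apply/le_anti; rewrite h1; move: Bp; rewrite o00 p00 => Bp.
by rewrite leNgt; apply/negP => hl; clear - Bp h0 hl; nra.
Qed.

End Minimal.

Lemma isotropic_q1 (n1 n2 p1 p2 : int) : n2 *+ 2 = p1 * p1 + p2 * p2 ->
  iQ ((n1, n2), (p1, p2), (1, 0)) ((n1, n2), (p1, p2), (1, 0)) = (0, 0).
Proof. by rewrite /iQ /gadd /gmul /gopp /gmuli /gconj /= => e; congr (_, _); lia. Qed.

Section Covering.
Variable R : realType.
Local Notation C := R[i].
Implicit Types (g : 'M[C]_3) (u v w : 'cV[C]_3).

Lemma minvec_Qre_neq0 w : 0 < Qre w -> w 2 0 != 0.
Proof.
apply: contraTneq => w0; rewrite -leNgt /Qre hermQE w0 rmorph0 !(mulr0, mul0r, subr0, sub0r).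
by rewrite nsqE /= oppr_le0 nsq_ge0.
Qed.

Lemma vec3_normalise w : w 2 0 != 0 -> w = w 2 0 *: vec3 (w 0 0 / w 2 0) (w 1 0 / w 2 0) 1.
Proof. by move=> w0; apply: cV3_eq; rewrite !mxE /= ?mulr1 // mulrC divfK. Qed.

Lemma normalise_at_e1 (c e : R) w : 0 < Qre w -> exists2 g, Gamma g &
  exists k (w1 w2 : C), [/\ g *m e1 R = e1 R, k != 0, g *m w = k *: vec3 w1 w2 1,
     `|complex.Re w2 - c| + `|complex.Im w2| <= 1 &
      `|complex.Re w1 + e * complex.Im w2| <= 1/2].
Proof.
move=> /minvec_Qre_neq0 w0.
have [m [n [r [w1 [w2 [E h1 h2]]]]]] := translate c e (w 0 0 / w 2 0) (w 1 0 / w 2 0).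
exists (mC R (itrans m n r)); first by apply: Gamma_mC; apply: iGamma_trans.
exists (w 2 0), w1, w2; split=> //.
  by rewrite trans_vec3 !mulr0 !addr0.
by rewrite {1}(vec3_normalise w0) -scalemxAr E.
Qed.

(* The height estimate: on the floor of the cell of the cusp (1, 0, 0) one has
   2 h = Q(w, w) / absQ2 >= 1, with equality only at the translates of (i, 1, 1). Around
   the hole w2 = 1 the four cusps w2 = 0, 2, 1 + i, 1 - i of denominator 1 and the two
   cusps of denominator 1 + i above the hole suffice to see this. *)
Lemma covering w : 0 < Qre w -> minvec w (e1 R) -> Qre w <= absQ2 (e1 R) w ->
  Qre w = absQ2 (e1 R) w /\
  exists2 g, Gamma g & exists2 k : C, k != 0 & g *m w = k *: vec3 'i 1 1.
Proof.
move=> Qw mw Qle; have [g Gg [k [w1 [w2 [ge k0 E h2 h1]]]]] := normalise_at_e1 1 1 Qw.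
have [_ mv] := mw; have kp : 0 < nsq k by rewrite nsq_gt0.
have FE v : absQ2 (g *m v) (g *m w) = absQ2 v w := absQ2_act v w (Gamma_SU21 Gg).
have QE : Qre w = nsq k * Qre (vec3 w1 w2 1).
  by rewrite -(Qre_act w (Gamma_SU21 Gg)) E Qre_Z.
have F1 : absQ2 (e1 R) w = nsq k by rewrite -FE ge E absQ2_Zr absQ2_e1 nsq1 mulr1.
have {}mv (v : ivec) : iQ v v = (0, 0) ->
    [|| inorm v.1.1 == 1, inorm v.1.2 == 1 | inorm v.2 == 1] -> 1 <= absQ2 (vC R v) (vec3 w1 w2 1).
  move=> v0 v1; have rv := reduced_isotropic_vC R v0 v1.
  have := mv _ (reduced_isotropic_act (Gamma_inv Gg) rv).
  by rewrite F1 -FE (Gamma_KV _ Gg) E absQ2_Zr -[X in X <= _]mulr1 (ler_pM2l kp).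
rewrite {}F1 in Qle *; rewrite {}QE in Qw Qle *.
rewrite -[X in _ <= X]mulr1 (ler_pM2l kp) in Qle; rewrite (pmulr_rgt0 _ kp) in Qw.
move: E h2 h1 mv Qw Qle {mw FE ge}.
case: w1 w2 => [x y] [a b] E; rewrite Qre_coords => h2 h1 mv Qw Qle.
suff [a1 b0 x0 y1] : [/\ a = 1, b = 0, x = 0 & y = 1].
  split; first by rewrite a1 b0 y1; lra.
  exists g => //; exists k => //; rewrite E a1 b0 x0 y1 iE.
  by congr (_ *: vec3 _ _ _).
have V n1 n2 p1 p2 q1 q2 := mv ((n1, n2), (p1, p2), (q1, q2)).
(* Since F is now 1 at (1, 0, 0), this is the h of the height estimate. The displacement of w2 from
   the hole is s + b i, and p is the vertical coordinate relative to the hole, which is why the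
   normalisation used c = e = 1. *)
set h := (2 * y - a ^+ 2 - b ^+ 2) / 2.
have h01 : 0 < h <= 1/2 by rewrite /h; apply/andP; split; lra.
set s := a - 1; set p := x + b.
have conv (A B C' D : R) : A = C' -> B = - D -> 1 <= A ^+ 2 + B ^+ 2 -> 1 <= C' ^+ 2 + D ^+ 2.
  by move=> -> ->; rewrite sqrrN.
have Bp : 1 <= 2 * ((h + (s ^+ 2 + b ^+ 2) / 2) ^+ 2 + (p + 1/2) ^+ 2).
  have := V (-1) 0 1 1 1 1 erefl erefl; rewrite absQ2_coords /= => H.
  apply: (le_trans H); rewrite le_eqVlt /h /s /p; apply/orP; left; apply/eqP.
  by field.
have Bm : 1 <= 2 * ((h + (s ^+ 2 + b ^+ 2) / 2) ^+ 2 + (p - 1/2) ^+ 2).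
  have := V 0 1 1 1 1 1 erefl erefl; rewrite absQ2_coords /= => H.
  apply: (le_trans H); rewrite le_eqVlt /h /s /p; apply/orP; left; apply/eqP.
  by field.
have p12 : `|p| <= 1/2 by rewrite /p -[b]mul1r.
have core s' t' : s' ^+ 2 + t' ^+ 2 = s ^+ 2 + b ^+ 2 -> `|t'| <= s' -> s' + `|t'| <= 1 ->
    (forall k : int, 1 <= (h + ((1 - s') ^+ 2 + t' ^+ 2) / 2) ^+ 2 + (p + t' + k%:~R) ^+ 2) ->
    [/\ s' = 0, t' = 0, p = 0 & h = 1/2].
  move=> e c1 c2 c3; apply: covering_core => //; rewrite ?e // => z.
  by rewrite !inE => /or3P[] /eqP ->; [apply: (c3 (-1)) | apply: (c3 0) | apply: (c3 1)].
have fin : [/\ s = 0, b = 0, p = 0 & h = 1/2] -> [/\ a = 1, b = 0, x = 0 & y = 1].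
  move=> [s0 b0 p0 hh]; have a1 : a = 1 by move: s0; rewrite /s; lra.
  have x0 : x = 0 by move: p0; rewrite /p b0; lra.
  by split=> //; move: hh; rewrite /h a1 b0; lra.
apply: fin; move: h2; rewrite -/s => h2.
have W n1 n2 p1 p2 (e : n2 *+ 2 = p1 * p1 + p2 * p2) :=
  V n1 n2 p1 p2 1 0 (@isotropic_q1 n1 n2 p1 p2 e).
have {}W n1 n2 p1 p2 (e : n2 *+ 2 = p1 * p1 + p2 * p2) := W n1 n2 p1 p2 e ltac:(by rewrite !orbT).
have neg0 (z : R) : - z = 0 -> z = 0 by move=> ?; lra.
(* The diamond is cut by its diagonals |b| = |s|; in the four pieces the nearest cusp is w2 = 2, 0,
   1 + i, 1 - i in turn, and the displacement is rotated to point towards it. *)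
have [bs|sb] := lerP `|b| `|s|.
  have [s0|s0] := ger0P s; move: bs h2.
    rewrite (ger0_norm s0) => bs h2; apply: (core s b erefl bs h2) => k'.
    have := W (- k') 2 2 0 erefl; rewrite absQ2_coords /= intrN.
    by apply: conv; rewrite /h /s /p; field.
  rewrite (ltr0_norm s0) => bs h2.
  have := @core (- s) (- b); rewrite !sqrrN normrN => /(_ erefl bs h2) [k'|/neg0 s1 /neg0 b1 p1 h3].
    have := W (- k') 0 0 0 erefl; rewrite absQ2_coords /= intrN.
    by apply: conv; rewrite /h /s /p; field.
  by split.
have [b0|b0] := ger0P b; move: sb h2; rewrite addrC.
  rewrite (ger0_norm b0) => sb h2.
  have := @core b (- s); rewrite sqrrN normrN [s ^+ 2 + _]addrC.
  move=> /(_ erefl (ltW sb) h2) [k'|s1 /neg0 b1 p1 h3].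
    have := W (- k' - 1) 1 1 1 erefl; rewrite absQ2_coords /= intrB intrN.
    by apply: conv; rewrite /h /s /p; field.
  by split.
rewrite (ltr0_norm b0) => sb h2.
have := @core (- b) s; rewrite sqrrN [s ^+ 2 + _]addrC.
move=> /(_ erefl (ltW sb) h2) [k'|/neg0 s1 b1 p1 h3].
  have := W (1 - k') 1 1 (-1) erefl; rewrite absQ2_coords /= intrB.
  by apply: conv; rewrite /h /s /p; field.
by split.
Qed.

End Covering.

(** * Finite enumerations *)

Definition iodd (x : gint) : bool := odd (absz (x.1 + x.2)).
(** Primitive at the prime 1 + i only: weaker than reduced, but a mere parity test and enough for
    the enumerations. *)
Definition iprim (v : ivec) : bool := [|| iodd v.1.1, iodd v.1.2 | iodd v.2].

Definition small_gints : seq gint :=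
  [seq (x, y) | x <- [:: -2; -1; 0; 1; 2], y <- [:: -2; -1; 0; 1; 2]].
Definition ibox : seq ivec :=
  [seq (np, q) | np <- [seq (n, p) | n <- small_gints, p <- small_gints], q <- small_gints].

Definition iorbit (v : ivec) : seq ivec := [seq iscale c v | c <- iunits].
Definition iorbits (L : seq ivec) : seq ivec := flatten [seq iorbit v | v <- L].

(** Below 4 the norm of a nonzero q is 1 or 2, so each unit orbit has exactly one vector with q = 1
    or q = 1 + i. The orbits left out, with q = 0 or n = 0, are those of (1, 0, 0) and (0, 0, 1). *)
Definition neighbours : seq ivec :=
  [seq v <- ibox | [&& v.2 \in [:: (1, 0); (1, 1)], iQ v v == (0, 0), iprim v,
                       inorm v.1.1 <= 3 & v.1.1 != (0, 0)]].

Definition icompat (u v : ivec) : bool := inorm (iQ u v) <= 3.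

(** The order of L is kept, so that a filtered sublist of pairwise compatible vectors occurs
    literally. *)
Fixpoint cliques (L : seq ivec) : seq (seq ivec) :=
  if L is v :: L' then
    let K := cliques L' in K ++ [seq v :: T | T <- K & all (icompat v) T]
  else [:: [::]].

Definition iJ2_1 : seq ivec := [:: ie1; ie3].
Definition iJ2_2 : seq ivec := [:: ie1; ((0, 1), (1, 1), (1, 1))].
Definition iJ3_1 : seq ivec := rcons iJ2_1 ((1, 0), (0, 0), (1, 0)).
Definition iJ3_2 : seq ivec := rcons iJ2_1 ((0, 1), (1, 1), (1, 0)).
Definition iJ3_3 : seq ivec := rcons iJ2_1 ((1, 1), (1, 1), (1, 0)).
Definition iJ4_1 : seq ivec := rcons iJ3_1 ((0, 1), (1, 1), (1, 0)).
Definition iJ4_2 : seq ivec := rcons iJ3_3 ((-1, 0), (-1, 1), (1, 1)).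
Definition iJ5 : seq ivec := rcons iJ4_1 ((1, 1), (1, 1), (1, 0)).
Definition iJ8 : seq ivec :=
  [:: ie1; ie3; ((-1, 0), (1, 1), (1, 1)); ((-1, 1), (1, 1), (1, 0));
      ((1, 1), (1, -1), (1, 0)); ((0, 1), (1, 1), (1, 1));
      ((0, 2), (2, 0), (1, 0)); ((0, 1), (2, 0), (2, 0))].
Definition ireps : seq (seq ivec) :=
  [:: iJ2_1; iJ2_2; iJ3_1; iJ3_2; iJ3_3; iJ4_1; iJ4_2; iJ5; iJ8].

(* The only element of SU(2,1) with outer columns a and b, when a and b are isotropic
   with Q(a, b) = i: its middle column is H times the conjugate of a x b. *)
Definition iframe (a b : ivec) : imat :=
  let c1 := gconj (gadd (gmul a.1.2 b.2) (gopp (gmul a.2 b.1.2))) in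
  let c2 := gconj (gadd (gmul a.2 b.1.1) (gopp (gmul a.1.1 b.2))) in
  let c3 := gconj (gadd (gmul a.1.1 b.1.2) (gopp (gmul a.1.2 b.1.1))) in
  (a, (gmuli c3, gopp c2, gopp (gmuli c1)), b).

Definition same_orbits (L L' : seq ivec) : bool :=
  all (fun v => v \in iorbits L') L && all (fun v => v \in iorbits L) L'.

Definition iconj (J L : seq ivec) (m : imat) : bool :=
  iGamma m && same_orbits [seq iapp m v | v <- J] L.

(* [find] and [if] rather than [has] and [&&]: call-by-value evaluation would not
   stop at the first success. *)
Definition short_has (T : Type) (p : pred T) (s : seq T) : bool := (find p s < size s)%N.

(** An element of SU(2,1) is determined by the images of (1, 0, 0) and (0, 0, 1). When J contains
    both, these images are unit multiples of members of L, so the frames taken from L exhaust the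
    candidates. *)
Definition recognised (L : seq ivec) : bool :=
  short_has (fun a => short_has (fun b =>
    if iQ a b == (0, 1) then
      short_has (fun J => if size J == size L then iconj J L (iframe a b) else false) ireps
    else false) (iorbits L)) (iorbits L).

Lemma short_hasP (T : Type) (p : pred T) (s : seq T) : short_has p s = has p s.
Proof. by rewrite /short_has has_find. Qed.

Lemma cliques_recognised :
  all (fun T => recognised (ie1 :: ie3 :: T)) (cliques neighbours).
Proof. by vm_compute. Qed.

Lemma ibox_neighbours :
  all (fun v => [&& iQ v v == (0, 0), iprim v, inorm v.1.1 <= 3 & inorm v.2 <= 3] ==>
         (v \in iorbits (ie1 :: ie3 :: neighbours))) ibox.
Proof. by vm_compute. Qed.

Definition iw8 : ivec := ((0, 1), (1, 0), (1, 0)).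

(** At h = 1/2 the pair bound only gives |Q|^2 <= 4, so the value of F has to be tested as well. *)
Lemma ibox_J8 :
  all (fun v => [&& iQ v v == (0, 0), iprim v, inorm v.1.1 <= 4, inorm v.2 <= 4
                  & inorm (iQ v iw8) <= 1] ==> (v \in iorbits iJ8)) ibox.
Proof. by vm_compute. Qed.

Lemma J8_iw8 : all (fun v => inorm (iQ v iw8) == 1) iJ8.
Proof. by vm_compute. Qed.

Lemma cliquesP (p : pred ivec) (L : seq ivec) :
  {in [seq v <- L | p v] &, forall u v, icompat u v} -> [seq v <- L | p v] \in cliques L.
Proof.
elim: L => [|v L IH] // H; rewrite [cliques _]/= mem_cat.
have IH' : [seq v <- L | p v] \in cliques L.
  apply: IH => x y hx hy; apply: H; rewrite /=.
    by case: ifP => _; rewrite ?inE hx ?orbT.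
  by case: ifP => _; rewrite ?inE hy ?orbT.
move: H; rewrite /=; case: ifP => [pv H|_ _]; last by rewrite IH'.
apply/orP; right; apply/mapP; exists [seq v <- L | p v] => //.
rewrite mem_filter IH' andbT; apply/allP => x hx.
by apply: H; rewrite ?inE ?eqxx ?hx ?orbT.
Qed.

Lemma recognisedP (L : seq ivec) : recognised L ->
  exists2 J, J \in ireps & exists m, iconj J L m.
Proof.
rewrite /recognised short_hasP => /hasP[a _]; rewrite short_hasP => /hasP[b _].
case: ifP => // _; rewrite short_hasP => /hasP[J hJ]; case: ifP => // _ h.
by exists J => //; exists (iframe a b).
Qed.

Lemma iorbitsP (L : seq ivec) (v : ivec) :
  reflect (exists2 u, u \in L & exists2 c, c \in iunits & v = iscale c u) (v \in iorbits L).
Proof.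
apply: (iffP flattenP) => [[s /mapP[u hu ->] /mapP[c hc ->]]|[u hu [c hc ->]]].
  by exists u => //; exists c.
by exists (iorbit u); apply/mapP; [exists u | exists c].
Qed.

Lemma int_abs_le2 (a : int) : a * a <= 8 -> a \in [:: -2; -1; 0; 1; 2].
Proof.
move=> h; have : -2 <= a <= 2 by nia.
move=> /andP[h1 h2]; rewrite !inE; lia.
Qed.

Lemma small_gintsP (x : gint) : inorm x <= 8 -> x \in small_gints.
Proof.
case: x => a b; rewrite /inorm /= => h.
by apply: allpairs_f; apply: int_abs_le2; nia.
Qed.

(** Isotropy bounds the middle coordinate: |p|^2 is twice the imaginary part of n times the
    conjugate of q, hence at most |n|^2 + |q|^2 <= 8. *)
Lemma ibox_small (v : ivec) : inorm v.1.1 <= 4 -> inorm v.2 <= 4 -> iQ v v = (0, 0) ->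
  v \in ibox.
Proof.
case: v => [[n p] q] /= hn hq [e _].
have np : (n, p) \in [seq (n, p) | n <- small_gints, p <- small_gints].
  apply: allpairs_f; apply: small_gintsP; first by lia.
  move: e hn hq; rewrite /inorm /=; case: n p q => [n1 n2] [p1 p2] [q1 q2] /= e hn hq.
  have := sqr_ge0 (n2 - q1); have := sqr_ge0 (n1 + q2); rewrite !expr2; lia.
apply: (allpairs_f (fun np q => (np, q)) np); apply: small_gintsP; lia.
Qed.

Lemma iunits_norm (c : gint) : (c \in iunits) = (inorm c == 1).
Proof.
apply/idP/idP => [|/eqP h]; first by rewrite !inE => /or4P[] /eqP ->.
have : c \in small_gints by apply: small_gintsP; rewrite h.
have : all (fun c => (inorm c == 1) ==> (c \in iunits)) small_gints by vm_compute.
by move=> /allP H /H; rewrite h.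
Qed.

Lemma inorm_even (x : gint) : ~~ iodd x -> exists y, x = gmul (1, 1) y.
Proof.
case: x => a b; rewrite /iodd /= => h.
have [k e] : exists k : int, a + b = k * 2.
  by exists (divz (a + b) 2); apply/esym/eqP; rewrite -dvdz_eq dvdzE /= dvdn2.
by exists (k, b - k); rewrite /gmul /=; congr (_, _); lia.
Qed.

Lemma inorm_neq3 (x : gint) : inorm x = 3 -> False.
Proof.
move=> h; have : x \in small_gints by apply: small_gintsP; rewrite h.
have : all (fun c => inorm c != 3) small_gints by vm_compute.
by move=> /allP H /H; rewrite h.
Qed.

(** * The types of sets of minimal vectors *)

(** Makes the parity of a square linear, as [lia] requires. *)
Lemma sq_parity (a : int) : exists t, a * a = a + 2 * t.
Proof.
have [k [->|->]] : exists k : int, a = 2 * k \/ a = 2 * k + 1.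
  by exists (divz a 2); lia.
  by exists (2 * k * k - k); lia.
by exists (2 * k * k + k); lia.
Qed.

(** Isotropy makes |p|^2 even, so p lies in (1 + i) Z[i], the lattice of middle translations. *)
Lemma itrans_ie3 (x : ivec) : iQ x x = (0, 0) -> x.2 = (1, 0) ->
  exists m n r, iapp (itrans m n r) x = ie3.
Proof.
case: x => [[[n1 n2] [p1 p2]] q] /= [e _] eq; move: e; rewrite {}eq /= => e.
have [m [n [e1 e2]]] : exists m n : int, p1 = - (m + n) /\ p2 = - (m - n).
  have : p1 * p1 + p2 * p2 = 2 * n2 by lia.
  have [k ->] : exists k : int, p2 = p1 + k by exists (p2 - p1); lia.
  move=> h; have [j ej] : exists j : int, k * k = 2 * j.
    by exists (n2 - p1 * p1 - p1 * k); lia.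
  have [l ->] : exists l : int, k = 2 * l.
    by exists (divz k 2); nia.
  by exists (- p1 - l), l; lia.
exists m, n, (- (n1 + (m - n) * p1 - (m + n) * p2)).
rewrite /iapp /iscale /iaddv /gadd /gmul /ie3 /= e1 e2 in e *.
by do ![congr (_, _)]; lia.
Qed.

(** Isotropy gives p = (1 + i)(a + c i), and then primitivity at 1 + i makes n, hence a + c, odd. As
    q = 1 + i, translations move a + c i by (1 + i) Z[i], so this parity is the only obstruction and
    a single orbit remains. *)
Lemma itrans_J2_2 (x : ivec) : iQ x x = (0, 0) -> x.2 = (1, 1) -> iprim x ->
  exists a c n, [/\ x = ((n, n + a * a + c * c), (a - c, a + c), (1, 1)),
     odd (absz (a + c)) & exists m n r, iapp (itrans m n r) x = ((0, 1), (1, 1), (1, 1))].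
Proof.
case: x => [[[n1 n2] [p1 p2]] q] /= [e _] eq; move: e; rewrite {}eq /iprim /iodd /= => e h.
have [a [c [ea ec]]] : exists a c : int, p1 = a - c /\ p2 = a + c.
  have : p1 * p1 + p2 * p2 = 2 * (n2 - n1) by lia.
  have [k ->] : exists k : int, p2 = p1 + k by exists (p2 - p1); lia.
  move=> h'; have [j ej] : exists j : int, k * k = 2 * j.
    by exists (n2 - n1 - p1 * p1 - p1 * k); lia.
  have [l ->] : exists l : int, k = 2 * l.
    by exists (divz k 2); nia.
  by exists (p1 + l), l; lia.
have en : n2 = n1 + a * a + c * c by rewrite ea ec in e; lia.
have oac : odd (absz (a + c)).
  move: h; have [s es] := sq_parity a; have [t et] := sq_parity c.
  rewrite ea ec en es et; lia.
exists a, c, n1; split=> //; first by rewrite ea ec en.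
have [m [n [em ep]]] : exists m n : int, a = 1 - m - n /\ c = n - m.
  exists (divz (1 - a - c) 2), (divz (1 - a + c) 2); lia.
exists m, n, (m * m + n * n - n1 - (m - n) * p1 + (m + n) * p2).
rewrite /iapp /iscale /iaddv /gadd /gmul /= en ea ec em ep.
by do ![congr (_, _)]; lia.
Qed.

(** The value of Q is (1 + i)(A + B i) with A and B of equal parity, so its norm 2 (A^2 + B^2) is a
    multiple of 4. *)
Lemma no_triangle (a c n : int) : odd (absz (a + c)) ->
  let x := ((n, n + a * a + c * c), (a - c, a + c), (1, 1)) in
  inorm (iQ ((0, 1), (1, 1), (1, 1)) x) <= 3 -> iQ ((0, 1), (1, 1), (1, 1)) x != (0, 0) -> False.
Proof.
move=> h x.
pose A := 1 - a - c - n; pose B := a - c - n - a * a - c * c.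
have -> : iQ ((0, 1), (1, 1), (1, 1)) x = (A - B, A + B).
  by rewrite /iQ /gadd /gmul /gopp /gmuli /gconj /A /B /=; congr (_, _); lia.
have [s es] := sq_parity a; have [t et] := sq_parity c.
have [k ->] : exists k, B = A + 2 * k by exists (divz (B - A) 2); rewrite /A /B es et; lia.
move: A => {B x es et} A; rewrite /inorm /= => H /eqP; apply.
have H2 : A * A + (A + 2 * k) * (A + 2 * k) <= 1 by lia.
have A1 : -1 <= A <= 1 by nia.
have B1 : -1 <= A + 2 * k <= 1 by nia.
have [A0|[A0|A0]] : A = 0 \/ A = 1 \/ A = -1 by lia.
- by congr (_, _); lia.
- by move: H2; rewrite A0; nia.
- by move: H2; rewrite A0; nia.
Qed.

Section Classification.
Variable R : realType.
Local Notation C := R[i].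
Implicit Types (g : 'M[C]_3) (u v w : 'cV[C]_3).

Lemma gunitP (c : C) : gunit c <-> exists2 x, x \in iunits & c = gC R x.
Proof.
split=> [[/gaussIntP[x ->]]|[x]]; last first.
  by rewrite iunits_norm => /eqP x1 ->; apply: gunit_gC.
rewrite nsq_gC -[1]/(1%:~R) => /eqP; rewrite eqr_int => x1.
by exists x => //; rewrite iunits_norm.
Qed.

Definition unit_multiples (L : seq ivec) v : Prop :=
  exists2 x, x \in L & exists2 c, gunit c & v = c *: vC R x.

Lemma unit_multiples_vC (L : seq ivec) (x : ivec) :
  unit_multiples L (vC R x) <-> x \in iorbits L.
Proof.
split=> [[u uL [c /gunitP[y hy ->]]]|/iorbitsP[u uL [y hy ->]]].
  by rewrite -vC_scale => /vC_inj ->; apply/iorbitsP; exists u => //; exists y.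
by exists u => //; exists (gC R y); [apply/gunitP; exists y | rewrite vC_scale].
Qed.

Lemma reduced_isotropic_iprim (x : ivec) :
  reduced_isotropic (vC R x) -> iQ x x = (0, 0) /\ iprim x.
Proof.
move=> [_ Qx [w [/gaussInt_vC[y ->] wx]]].
split; first by apply: (@gC_inj R); rewrite -iQP Qx gC0.
apply/negPn/negP; rewrite /iprim !negb_or.
move=> /and3P[/inorm_even[a ea] /inorm_even[b eb] /inorm_even[c ec]].
move: wx; rewrite sum3 !vec3E ea eb ec -!gC_mul -!gC_add -(gC1 R) => /gC_inj.
case: y a b c {ea eb ec} => [[[y1 y2] [y3 y4]] [y5 y6]] [a1 a2] [b1 b2] [c1 c2].
by rewrite /gadd /gmul /= => -[]; lia.
Qed.

Lemma minvec_ivec w v : minvec w v -> exists x, [/\ v = vC R x, iQ x x = (0, 0) & iprim x].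
Proof.
move=> [rv _]; have [iv _ _] := rv; have [x ex] := gaussInt_vC iv.
by rewrite ex in rv; have [] := reduced_isotropic_iprim rv; exists x.
Qed.

(** Once v is moved to (1, 0, 0), orthogonality kills the last coordinate of u and isotropy then
    kills the middle one. *)
Lemma isotropic_orth v u : reduced_isotropic v -> reduced_isotropic u -> hermQ v u = 0 ->
  exists2 c, gunit c & u = c *: v.
Proof.
move=> rv ru Q0; have [g Gg [c uc e]] := cusp_transitive rv.
have Sg := Gamma_SU21 Gg; have rgu := reduced_isotropic_act Gg ru.
have q0 : (g *m u) 2 0 = 0.
  have : hermQ (g *m v) (g *m u) = 0 by rewrite SU21_hermQ.
  rewrite e hermQZl hermQ_e1 => /eqP; rewrite !mulf_eq0 conjC_eq0 (negPf (gunit_neq0 uc)) /=.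
  by rewrite -(nsq_eq0 'i) nsq_i oner_eq0 /= => /eqP.
have [_ Qgu _] := rgu; have E := isotropic_q0 Qgu q0.
have [uc' cc] := gunit_inv uc.
have E2 : u = ((g *m u) 0 0 * c^*) *: v.
  rewrite -{1}(Gamma_K u Gg) {1}E -scalemxAr.
  have -> : e1 R = c^* *: (g *m v) by rewrite e scalerA cc scale1r.
  by rewrite -scalemxAr (Gamma_K v Gg) scalerA.
by exists ((g *m u) 0 0 * c^*) => //; apply: (reduced_isotropic_prop rv ru E2).
Qed.

Definition has_type w (L : seq ivec) : Prop :=
  exists2 g, Gamma g & forall v, minvec w (g *m v) <-> unit_multiples L v.

Lemma has_type_act g w L : Gamma g -> has_type (g *m w) L -> has_type w L.
Proof.
move=> Gg [h Gh H]; exists (invmx g *m h); first by apply: Gamma_mul => //; apply: Gamma_inv.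
by move=> v; rewrite -mulmxA -(minvec_actE _ _ Gg).
Qed.

Lemma has_typeZ (c : C) w L : c != 0 -> has_type w L -> has_type (c *: w) L.
Proof.
move=> c0 [h Gh H]; exists h; first exact: Gh.
by move=> v; rewrite -H; exact: (minvecZ w (h *m v) c0).
Qed.

Lemma minvec_pair w u v : 0 < Qre w -> minvec w u -> minvec w v ->
  nsq (hermQ u v) * Qre w ^+ 2 <= (2 * absQ2 u w) ^+ 2.
Proof.
move=> Qw mu mv; have [[_ Qu _] _] := mu; have [[_ Qv _] _] := mv.
have := pair_bound Qu Qv Qw; rewrite (minvec_F mv mu) => H; apply: (le_trans H).
by rewrite le_eqVlt; apply/orP; left; apply/eqP; ring.
Qed.

(** The place where h > 1/2 becomes an integral bound: |Q|^2 < 4. *)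
Lemma minvec_pair_lt w x y : absQ2 (vC R x) w < Qre w ->
  minvec w (vC R x) -> minvec w (vC R y) -> inorm (iQ x y) <= 3.
Proof.
move=> Fw mx my; have Q0 : 0 < Qre w := le_lt_trans (absQ2_ge0 _ _) Fw.
have := minvec_pair Q0 mx my; rewrite iQP nsq_gC => h.
have {h} : (inorm (iQ x y))%:~R < 4%:~R :> R.
  move: h Fw (absQ2_ge0 (vC R x) w); move: (_%:~R) (Qre w) (absQ2 _ w) Q0 => N Q f Q0 h fq f0.
  rewrite -(ltr_pM2r (exprn_gt0 2 Q0)); apply: (le_lt_trans h).
  by have : f * f < Q * Q; nra.
by rewrite ltr_int; lia.
Qed.

End Classification.

Definition iunimodular (v : ivec) : bool :=
  (iQ v v == (0, 0)) && [|| inorm v.1.1 == 1, inorm v.1.2 == 1 | inorm v.2 == 1].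

Lemma ireps_unimodular : all (all iunimodular) ireps.
Proof. by vm_compute. Qed.

Lemma unit_norm1 (z : gint) : inorm z = 1 -> exists2 c, c \in iunits & gmul c z = (1, 0).
Proof.
move=> z1; have : z \in small_gints by apply: small_gintsP; rewrite z1.
have : all (fun z => (inorm z == 1) ==> has (fun c => gmul c z == (1, 0)) iunits) small_gints.
  by vm_compute.
by move=> /allP H /H; rewrite z1 => /hasP[c hc /eqP e]; exists c.
Qed.

Lemma unit_norm2 (z : gint) : inorm z = 2 -> exists2 c, c \in iunits & gmul c z = (1, 1).
Proof.
move=> z1; have : z \in small_gints by apply: small_gintsP; rewrite z1.
have : all (fun z => (inorm z == 2) ==> has (fun c => gmul c z == (1, 1)) iunits) small_gints.
  by vm_compute.
by move=> /allP H /H; rewrite z1 => /hasP[c hc /eqP e]; exists c.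
Qed.

Section Types.
Variable R : realType.
Local Notation C := R[i].
Implicit Types (g : 'M[C]_3) (u v w : 'cV[C]_3).

Lemma iunimodularP (x : ivec) : iunimodular x -> reduced_isotropic (vC R x).
Proof. by move=> /andP[/eqP x0 x1]; apply: reduced_isotropic_vC. Qed.

Lemma reps_reduced (J : seq ivec) (x : ivec) :
  J \in ireps -> x \in J -> reduced_isotropic (vC R x).
Proof.
by move=> hJ hx; apply: iunimodularP; apply: (allP (allP ireps_unimodular _ hJ)).
Qed.

Lemma iQ_ie1 (x : ivec) : inorm (iQ ie1 x) = inorm x.2.
Proof.
by case: x => [[n p] [q1 q2]]; rewrite /iQ /inorm /gadd /gmul /gopp /gmuli /gconj /=; lia.
Qed.

Lemma iQ_ie3 (x : ivec) : inorm (iQ ie3 x) = inorm x.1.1.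
Proof.
by case: x => [[[n1 n2] p] q]; rewrite /iQ /inorm /gadd /gmul /gopp /gmuli /gconj /=; lia.
Qed.

Lemma absQ2_vC (x y : ivec) : absQ2 (vC R x) (vC R y) = (inorm (iQ x y))%:~R.
Proof. by rewrite /absQ2 iQP nsq_gC. Qed.

Lemma le_4mul (a f : R) : a <= 4 * f -> f <= 1 -> a <= 4.
Proof. lra. Qed.

(** At (i, 1, 1) the function F is integer-valued, so a value below 1 would be 0. The pair bound
    would then make the vector orthogonal to (1, 0, 0), hence proportional to it, where F is 1. *)
Lemma minvec_iw8 v : minvec (vC R iw8) v <-> @unit_multiples R iJ8 v.
Proof.
have Q1 : Qre (vC R iw8) = 1 by rewrite /Qre iQP.
have Q0 : 0 < Qre (vC R iw8) by rewrite Q1.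
have r1 := reduced_isotropic_e1 R.
have F1 : absQ2 (e1 R) (vC R iw8) = 1 by rewrite -vC_ie1 absQ2_vC.
have F3 : absQ2 (vC R ie3) (vC R iw8) = 1 by rewrite absQ2_vC.
have r3 : reduced_isotropic (vC R ie3) by apply: (@reps_reduced iJ8); vm_compute.
have low u : reduced_isotropic u -> 1 <= absQ2 u (vC R iw8).
  move=> ru; rewrite leNgt; apply/negP.
  have [iu Qu _] := ru; have [x ex] := gaussInt_vC iu.
  rewrite {1}ex absQ2_vC -[1]/(1%:~R) ltr_int => Fu.
  have {}Fu : absQ2 u (vC R iw8) = 0.
    by rewrite ex absQ2_vC (_ : inorm _ = 0) //; have := inorm_ge0 (iQ x iw8); lia.
  have [_ Qe _] := r1; have := pair_bound Qe Qu Q0.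
  rewrite Fu mulr0 Q1 expr1n mulr1 => h.
  have q0 : hermQ (e1 R) u = 0.
    by apply/eqP; rewrite -nsq_eq0; apply/eqP/le_anti; rewrite h nsq_ge0.
  have [c [_ c1] E] := isotropic_orth r1 ru q0.
  have : absQ2 u (vC R iw8) = 1 by rewrite E absQ2_Zl.
  by rewrite Fu => /esym/eqP; rewrite oner_eq0.
split=> [mv|].
  have [x [ex Qx px]] := minvec_ivec mv; rewrite {}ex in mv *.
  apply/unit_multiples_vC.
  have Fx : absQ2 (vC R x) (vC R iw8) <= 1 by rewrite -F1; apply: (proj2 mv).
  have [rx _] := mv; have [_ Qx' _] := rx.
  have bd y : reduced_isotropic (vC R y) -> absQ2 (vC R y) (vC R iw8) = 1 -> inorm (iQ y x) <= 4.
    move=> [_ Qy _] Fy; have := pair_bound Qy Qx' Q0.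
    rewrite Q1 Fy expr1n !mulr1 iQP nsq_gC => h.
    have : (inorm (iQ y x))%:~R <= 4%:~R :> R by apply: le_4mul h Fx.
    by rewrite ler_int.
  have n4 : inorm x.1.1 <= 4 by rewrite -iQ_ie3; apply: bd.
  have q4 : inorm x.2 <= 4 by rewrite -iQ_ie1; apply: bd; rewrite vC_ie1.
  have F4 : inorm (iQ x iw8) <= 1 by move: Fx; rewrite absQ2_vC -[1]/(1%:~R) ler_int.
  have := allP ibox_J8 x (ibox_small n4 q4 Qx).
  by rewrite Qx eqxx px n4 q4 F4.
move=> [x xJ [c uc ->]]; apply: (proj2 (minvec_unit _ _ uc)); split.
  exact: (@reps_reduced iJ8).
move=> u ru; rewrite absQ2_vC; have := allP J8_iw8 x xJ => /eqP ->; exact: low.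
Qed.

Lemma type_e1_e3 w : absQ2 (e1 R) w < Qre w -> minvec w (e1 R) -> minvec w (e3 R) ->
  exists2 J, J \in ireps & has_type w J.
Proof.
rewrite -vC_ie1 -vC_ie3 => Fw m1 m3.
(* A classical filter: whatever w is, [T] is one of the finitely many members of
   [cliques neighbours]. *)
pose T := [seq x <- neighbours | `[< minvec w (vC R x) >]].
pose L := ie1 :: ie3 :: T.
have pairs x y : minvec w (vC R x) -> minvec w (vC R y) -> inorm (iQ x y) <= 3.
  by move=> mx my; apply: (minvec_pair_lt _ mx my); rewrite (minvec_F mx m1).
have mL v : minvec w v <-> @unit_multiples R L v.
  split=> [mv|[x xL [c uc ->]]]; last first.
    apply: (proj2 (minvec_unit w _ uc)); move: xL; rewrite in_cons in_cons.
    move=> /or3P[/eqP -> | /eqP -> |]; [exact: m1 | exact: m3 |].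
    by rewrite mem_filter => /andP[/asboolP].
  have [x [ex Qx px]] := minvec_ivec mv; rewrite {}ex in mv *.
  have n3 : inorm x.1.1 <= 3 by rewrite -iQ_ie3; apply: pairs.
  have q3 : inorm x.2 <= 3 by rewrite -iQ_ie1; apply: pairs.
  have n4 : inorm x.1.1 <= 4 by apply: (le_trans n3).
  have q4 : inorm x.2 <= 4 by apply: (le_trans q3).
  have := allP ibox_neighbours x (ibox_small n4 q4 Qx).
  rewrite Qx eqxx px n3 q3 => /iorbitsP[y hy [c hc ec]].
  have uc : gunit (gC R c) by apply/gunitP; exists c.
  exists y; last by exists (gC R c); rewrite // ec vC_scale.
  move: hy; rewrite in_cons in_cons /L => /or3P[h|h|hy].
  - by rewrite in_cons h.
  - by rewrite in_cons in_cons h orbT.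
  rewrite in_cons in_cons; apply/or3P; apply: Or33; rewrite mem_filter hy andbT.
  by apply/asboolP; move: mv; rewrite ec vC_scale; apply: (proj1 (minvec_unit _ _ uc)).
have TK : T \in cliques neighbours.
  apply: cliquesP => x y; rewrite !mem_filter => /andP[/asboolP mx _] /andP[/asboolP my _].
  exact: pairs.
have [J hJ [m /andP[Gm /andP[/allP JL /allP LJ]]]] := recognisedP (allP cliques_recognised _ TK).
have G := @Gamma_mC R _ Gm.
exists J; first exact: hJ.
exists (mC R m); first exact: G.
move=> v; rewrite mL; clear - G JL LJ; split=> [[x /LJ xJ [c uc e]]|[x xJ [c uc ->]]].
  have [y /mapP[z zJ ->] [d hd ex]] := iorbitsP _ _ xJ.
  exists z; first exact: zJ.
  exists (c * gC R d); first by apply: (gunit_mul uc); apply/gunitP; exists d.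
  by rewrite -[v](Gamma_K v G) e ex vC_scale iappP -!scalemxAr (Gamma_K _ G) scalerA.
have /JL/iorbitsP[y yL [d hd ed]] := map_f (iapp m) xJ.
exists y; first exact: yL.
exists (c * gC R d); first by apply: (gunit_mul uc); apply/gunitP; exists d.
by rewrite -scalemxAr -iappP ed vC_scale scalerA.
Qed.

(** A minimal vector with q nonzero has |q|^2 = 2, since 1 is excluded by hypothesis and 3 is not a
    norm. A unit brings q to 1 + i, and [no_triangle] makes the vector orthogonal, hence
    proportional, to y. *)
Lemma minvec_J2_2 w (y : ivec) : y = ((0, 1), (1, 1), (1, 1)) ->
  absQ2 (e1 R) w < Qre w -> minvec w (e1 R) -> minvec w (vC R y) ->
  (forall u v, minvec w u -> minvec w v -> nsq (hermQ u v) <> 1) ->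
  forall v, minvec w v <-> @unit_multiples R iJ2_2 v.
Proof.
move=> ey Fw m1 my no1 v; rewrite -vC_ie1 in Fw m1.
have pairs x z : minvec w (vC R x) -> minvec w (vC R z) -> inorm (iQ x z) <= 3.
  by move=> mx mz; apply: (minvec_pair_lt _ mx mz); rewrite (minvec_F mx m1).
have y2 : y \in iJ2_2 by rewrite ey !inE eqxx orbT.
split=> [mv|[x]]; last first.
  rewrite !inE => /orP[] /eqP -> [c uc ->]; apply: (proj2 (minvec_unit w _ uc)).
    exact: m1.
  by rewrite -ey; exact: my.
have orth x : x \in iJ2_2 -> minvec w (vC R x) -> hermQ (vC R x) v = 0 -> unit_multiples iJ2_2 v.
  move=> xJ mx /(isotropic_orth (proj1 mx) (proj1 mv)) [c uc ->].
  by exists x => //; exists c.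
have [x [ex Qx px]] := minvec_ivec mv; have mx := mv; rewrite ex in mx.
have : inorm x.2 <= 3 by rewrite -iQ_ie1; apply: pairs.
have n1 : inorm x.2 <> 1.
  by move=> e; have := no1 _ _ m1 mx; rewrite iQP nsq_gC iQ_ie1 e.
have n3 := @inorm_neq3 x.2; have := inorm_ge0 x.2.
have [q0 _ _|q0 q1 q2] := eqVneq (inorm x.2) 0.
  apply: (@orth ie1) => //; apply/eqP; rewrite -nsq_eq0 ex iQP nsq_gC iQ_ie1 q0.
  by rewrite eqxx.
have q2' : inorm x.2 = 2 by move: q0 n1 n3 q1 q2; move: (inorm x.2) => k; lia.
have [c hc ec] := unit_norm2 q2'.
have uc : gunit (gC R c) by apply/gunitP; exists c.
have {}mx : minvec w (vC R (iscale c x)) by rewrite vC_scale; apply: (proj2 (minvec_unit w _ uc)).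
have [z [ez Qz pz]] := minvec_ivec mx; have {}ez := vC_inj ez; rewrite -{}ez in Qz pz.
have [a [b [n [E oab _]]]] := itrans_J2_2 Qz ec pz.
apply: (orth y) => //; apply/eqP; rewrite -(inj_eq (mulfI (gunit_neq0 uc))) mulr0.
rewrite -hermQZr ex -vC_scale iQP -(gC0 R) (inj_eq (@gC_inj R)); apply/negPn/negP.
have := pairs _ _ my mx; rewrite E ey; exact: no_triangle.
Qed.

Lemma normalise_pair w u v : minvec w u -> minvec w v -> exists2 g, Gamma g &
  exists x, [/\ minvec (g *m w) (e1 R), minvec (g *m w) (vC R x) &
                 nsq (hermQ u v) = (inorm x.2)%:~R].
Proof.
move=> mu mv; have [g Gg [c uc e]] := cusp_transitive (proj1 mu).
have mgv := minvec_act Gg mv; have [x [ex _ _]] := minvec_ivec mgv.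
exists g => //; exists x; split; last 1 first.
- rewrite -(SU21_hermQ u v (Gamma_SU21 Gg)) e hermQZl nsqM nsq_conj (proj2 uc) mul1r ex.
  by rewrite -vC_ie1 iQP nsq_gC iQ_ie1.
- by have := minvec_act Gg mu; rewrite e; apply: (proj1 (minvec_unit _ _ uc)).
- by rewrite -ex.
Qed.

Lemma minvec_iscale w c x : c \in iunits -> minvec w (vC R x) -> minvec w (vC R (iscale c x)).
Proof.
by rewrite vC_scale => hc mx; apply: (proj2 (minvec_unit _ _ _)) mx; apply/gunitP; exists c.
Qed.

Lemma minvec_itrans w m n r x : minvec w (e1 R) -> minvec w (vC R x) ->
  let g := mC R (itrans m n r) in
  [/\ Gamma g, minvec (g *m w) (e1 R) & minvec (g *m w) (vC R (iapp (itrans m n r) x))].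
Proof.
move=> m1 mx g; have Gg : Gamma g by apply: Gamma_mC; apply: iGamma_trans.
split; first exact: Gg.
  by have := minvec_act Gg m1; rewrite trans_vec3 !mulr0 !addr0.
by rewrite iappP; apply: minvec_act.
Qed.

(* Sets of at least two cusps are sorted by h: either h = 1/2, and w is a translate of
   (i, 1, 1); or h > 1/2, and then |Q(u, v)|^2 <= 3 for all minimal u and v. *)
Theorem minvec_classification w u0 v0 : 0 < Qre w ->
  minvec w u0 -> minvec w v0 -> hermQ u0 v0 != 0 -> exists2 J, J \in ireps & has_type w J.
Proof.
move=> Qw mu0 mv0 Q0; have [Fw|Fw] := lerP (Qre w) (absQ2 u0 w).
  exists iJ8; first by rewrite /ireps !inE eqxx !orbT.
  have [g Gg [c uc e]] := cusp_transitive (proj1 mu0).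
  have m1 : minvec (g *m w) (e1 R).
    by have := minvec_act Gg mu0; rewrite e; apply: (proj1 (minvec_unit _ _ uc)).
  have Qg := Qre_act w (Gamma_SU21 Gg).
  have F1 : absQ2 (e1 R) (g *m w) = absQ2 u0 w.
    by rewrite -(absQ2_act u0 w (Gamma_SU21 Gg)) e absQ2_Zl; [|case: uc].
  have [] := @covering R (g *m w); rewrite ?Qg ?F1 //.
  move=> _ [h Gh [k k0 E]].
  apply: (has_type_act Gg); apply: (has_type_act Gh); rewrite E; apply: (has_typeZ k0).
  have -> : vec3 'i 1 1 = vC R iw8 by rewrite /vC /= gCi gC1.
  exists 1%:M; first exact: Gamma_1.
  by move=> v; rewrite mul1mx; exact: (minvec_iw8 v).
have FQ h : Gamma h -> minvec (h *m w) (e1 R) -> absQ2 (e1 R) (h *m w) < Qre (h *m w).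
  move=> Gh mh; rewrite (minvec_F mh (minvec_act Gh mu0)) (absQ2_act _ _ (Gamma_SU21 Gh)).
  by rewrite (Qre_act _ (Gamma_SU21 Gh)).
(* The given pair may have |Q|^2 = 2 while another one has 1, so the pair is chosen anew. *)
have [[u [v [mu mv uv]]]|no1] :=
  pselect (exists u v, [/\ minvec w u, minvec w v & nsq (hermQ u v) = 1]).
  have [g Gg [x [m1 mx]]] := normalise_pair mu mv.
  rewrite uv -[1]/(1%:~R) => /esym/eqP; rewrite eqr_int => /eqP /unit_norm1[c hc ec].
  have {}mx := minvec_iscale hc mx.
  have [z [ez Qz pz]] := minvec_ivec mx; have {}ez := vC_inj ez; rewrite -{}ez in Qz pz.
  have [m [n [r E]]] := itrans_ie3 Qz ec.
  have [Gt m1' m3] := minvec_itrans m n r m1 mx; rewrite E vC_ie3 in m3.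
  have [|J hJ tJ] := type_e1_e3 _ m1' m3.
    by rewrite mulmxA; apply: FQ; [apply: Gamma_mul | rewrite -mulmxA].
  exists J; first exact: hJ.
  by apply: (has_type_act Gg); apply: (has_type_act Gt).
have [g Gg [x [m1 mx Qx]]] := normalise_pair mu0 mv0.
have n1 : inorm x.2 <> 1.
  by move=> e; apply: no1; exists u0, v0; split=> //; rewrite Qx e.
have n0 : inorm x.2 <> 0.
  by move=> e; move: Q0; rewrite -nsq_eq0 Qx e eqxx.
have n3 : inorm x.2 <= 3.
  rewrite -iQ_ie1; apply: (@minvec_pair_lt R (g *m w)); rewrite ?vC_ie1 //.
  exact: FQ.
have n2 : inorm x.2 = 2.
  have n3' := @inorm_neq3 x.2; have := inorm_ge0 x.2.
  by move: n0 n1 n3 n3'; move: (inorm x.2) => k; lia.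
have [c hc ec] := unit_norm2 n2.
have {}mx := minvec_iscale hc mx.
have [z [ez Qz pz]] := minvec_ivec mx; have {}ez := vC_inj ez; rewrite -{}ez in Qz pz.
have [_ [_ [_ [_ _ [m [n [r E]]]]]]] := itrans_J2_2 Qz ec pz.
have [Gt m1' m2] := minvec_itrans m n r m1 mx.
exists iJ2_2; first by rewrite /ireps !inE eqxx !orbT.
apply: (has_type_act Gg); apply: (has_type_act Gt); exists 1%:M; first exact: Gamma_1.
move=> v; rewrite mul1mx; apply: (minvec_J2_2 E) => //.
  by rewrite mulmxA; apply: FQ; [apply: Gamma_mul | rewrite -mulmxA].
move=> u' v'; rewrite mulmxA => mu' mv' e; apply: no1.
have Gh := Gamma_mul Gt Gg; have Gi := Gamma_inv Gh.
exists (invmx (mC R (itrans m n r) *m g) *m u'), (invmx (mC R (itrans m n r) *m g) *m v').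
by split; [apply/minvec_actE | apply/minvec_actE | rewrite SU21_hermQ //; apply: Gamma_SU21].
Qed.

End Types.

(** * Explicit points *)

Section Realisation.
Variable R : realType.
Local Notation C := R[i].
Implicit Types (g : 'M[C]_3) (u v w : 'cV[C]_3).

Definition realises w (J : seq ivec) : Prop :=
  0 < Qre w /\ forall v, minvec w v <-> unit_multiples J v.

Lemma pair_lt4 (N Q f f' : R) : 0 <= f -> f < Q -> 0 <= f' -> f' <= f ->
  N * Q ^+ 2 <= 4 * f * f' -> N < 4.
Proof.
move=> f0 fQ f0' ff h; have Q0 : 0 < Q by apply: le_lt_trans fQ.
rewrite -(ltr_pM2r (exprn_gt0 2 Q0)); apply: (le_lt_trans h).
have : f * f' <= f * f by rewrite ler_wpM2l.
have : f * f < Q * Q by rewrite ltr_pM.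
lra.
Qed.

(** The existence of a minimum need not be known beforehand: a vector below the threshold would
    belong to J, where F equals the threshold. *)
Lemma realises_threshold w (J : seq ivec) : 0 < Qre w -> ie1 \in J ->
  {in J, forall x, reduced_isotropic (vC R x) /\ absQ2 (vC R x) w = absQ2 (e1 R) w} ->
  (forall v, reduced_isotropic v -> absQ2 v w <= absQ2 (e1 R) w -> unit_multiples J v) ->
  realises w J.
Proof.
move=> Qw e1J HJ H; split; first exact: Qw.
have FJ v : unit_multiples J v -> absQ2 v w = absQ2 (e1 R) w.
  by move=> [x xJ [c [_ c1] ->]]; rewrite (absQ2_Zl _ _ c1); apply: (HJ x xJ).2.
move=> v; split=> [[rv mv]|uv].
  by apply: (H v rv); apply: mv; exact: reduced_isotropic_e1.
split.
  by move: uv => [x xJ [c uc ->]]; apply: (reduced_isotropic_unit uc); apply: (HJ x xJ).1.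
move=> u ru; rewrite (FJ v uv) leNgt; apply/negP => h.
by move: (h); rewrite (FJ u (H u ru (ltW h))) ltxx.
Qed.

(** The pair bound with (1, 0, 0) and (0, 0, 1) disposes of all but finitely many competitors, so
    that only [neighbours] has to be compared. *)
Lemma realises_e1_e3 w (J : seq ivec) :
  J \in ireps -> ie1 \in J -> ie3 \in J -> absQ2 (e1 R) w < Qre w ->
  {in J, forall x, absQ2 (vC R x) w = absQ2 (e1 R) w} ->
  {in neighbours, forall x, x \notin iorbits J -> absQ2 (e1 R) w < absQ2 (vC R x) w} ->
  realises w J.
Proof.
move=> hJ e1J e3J FQ HJ Hn; have Qw : 0 < Qre w := le_lt_trans (absQ2_ge0 _ _) FQ.
apply: (realises_threshold Qw e1J) => [x xJ|v rv Fv].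
  by split; [apply: (reps_reduced R hJ xJ) | apply: HJ].
have [iv Qv _] := rv; have [x ex] := gaussInt_vC iv; rewrite {}ex in rv Fv Qv *.
have [Qx px] := reduced_isotropic_iprim rv.
have bd y : y \in J -> inorm (iQ y x) <= 3.
  move=> yJ; have [_ Qy _] := reps_reduced R hJ yJ.
  have := pair_bound Qy Qv Qw; rewrite (HJ y yJ) iQP nsq_gC.
  move=> /(pair_lt4 (absQ2_ge0 _ _) FQ (absQ2_ge0 _ _) Fv).
  by rewrite -[4]/(4%:~R) ltr_int; clear; lia.
have n3 : inorm x.1.1 <= 3 by rewrite -iQ_ie3; apply: bd.
have q3 : inorm x.2 <= 3 by rewrite -iQ_ie1; apply: bd.
have n4 : inorm x.1.1 <= 4 by apply: (le_trans n3).
have q4 : inorm x.2 <= 4 by apply: (le_trans q3).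
have := allP ibox_neighbours x (ibox_small n4 q4 Qx).
rewrite Qx eqxx px n3 q3 => /iorbitsP[y hy [c hc ec]].
have uc : gunit (gC R c) by apply/gunitP; exists c.
suff : y \in iorbits J.
  move=> /(unit_multiples_vC R)[z zJ [d ud ez]].
  by exists z => //; exists (gC R c * d); [apply: gunit_mul | rewrite ec vC_scale ez scalerA].
have self z : z \in J -> z \in iorbits J.
  move=> zJ; apply/iorbitsP; exists z => //; exists (1, 0); first by [].
  by case: z {zJ} => [[[a b] [p q]] [m n]]; rewrite /iscale /gmul /= !mul0r !mul1r !subr0 ?addr0.
move: hy; rewrite in_cons in_cons => /or3P[/eqP -> | /eqP -> | hy].
- exact: self.
- exact: self.
apply/negPn/negP => /(Hn y hy); rewrite ltNge; move: Fv.
by rewrite ec vC_scale (absQ2_Zl _ _ (proj2 uc)) => ->.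
Qed.

Definition irealises (w : ivec) (J : seq ivec) : bool :=
  let f := inorm (iQ ie1 w) in
  [&& J \in ireps, ie1 \in J, ie3 \in J, f < (iQ w w).1,
      all (fun x => inorm (iQ x w) == f) J &
      all (fun x => (x \in iorbits J) || (f < inorm (iQ x w))) neighbours].

Lemma irealisesP (w : ivec) (J : seq ivec) : irealises w J -> realises (vC R w) J.
Proof.
move=> /and5P[hJ e1J e3J fQ /andP[/allP HJ /allP Hn]].
apply: (realises_e1_e3 hJ e1J e3J).
- by rewrite -vC_ie1 absQ2_vC /Qre iQP /= ltr_int.
- by move=> x /HJ /eqP e; rewrite -vC_ie1 !absQ2_vC e.
move=> x /Hn h /negPf xJ; move: h; rewrite xJ -vC_ie1 !absQ2_vC ltr_int; exact: id.
Qed.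

Lemma realises_J2_1 : realises (vC R ((0, 1), (0, 0), (1, 0))) iJ2_1.
Proof. by apply: irealisesP; vm_compute. Qed.
Lemma realises_J3_2 : realises (vC R ((0, 2), (1, 1), (2, 0))) iJ3_2.
Proof. by apply: irealisesP; vm_compute. Qed.
(** The triple 5, 12, 13 makes the three values of Q, up to units 13, 5 + 12 i and 12 + 5 i, equal
    in modulus. *)
Lemma realises_J3_3 : realises (vC R ((5, 12), (5, 8), (13, 0))) iJ3_3.
Proof. by apply: irealisesP; vm_compute. Qed.
(** The triple 7, 24, 25: at the last two vectors Q takes the values 24 + 7 i and 7 - 24 i. *)
Lemma realises_J4_2 : realises (vC R ((0, 25), (4, 22), (25, 0))) iJ4_2.
Proof. by apply: irealisesP; vm_compute. Qed.
Lemma realises_J8 : realises (vC R iw8) iJ8.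
Proof. by split; [rewrite /Qre iQP | exact: minvec_iw8]. Qed.

Fixpoint all_prop (P : ivec -> Prop) (L : seq ivec) : Prop :=
  if L is x :: L' then P x /\ all_prop P L' else True.

Lemma all_propP P L : all_prop P L -> {in L, forall x, P x}.
Proof.
elim: L => [_ x //|y L IH [Py /IH PL] x].
by rewrite in_cons => /orP[/eqP -> //|/PL].
Qed.

(** Equal values of F at (1, 0, 0), (0, 0, 1) and (1, 0, 1) force w1 / w3 to be a primitive sixth
    root of unity, so no Gaussian w realises a set containing these three. *)
Definition sqrt3 : R := Num.sqrt 3.
Lemma sqrt3_sqr : sqrt3 * sqrt3 = 3.
Proof. by rewrite -expr2 sqr_sqrtr. Qed.
Lemma sqrt3_bounds : 173/100 < sqrt3 < 174/100.
Proof.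
have := sqrt3_sqr; have := sqrtr_ge0 (3 : R); rewrite -/sqrt3; move: sqrt3 => s s0 ss.
by apply/andP; split; nra.
Qed.

Ltac check_coords :=
  have := sqrt3_sqr; have /andP[] := sqrt3_bounds; move: sqrt3 => s s1 s2 ss;
  rewrite absQ2_coords /=; lra.

Lemma realises_coords (J : seq ivec) (x y a b : R) :
  J \in ireps -> ie1 \in J -> ie3 \in J -> 1 < 2 * y - a ^+ 2 - b ^+ 2 ->
  let w := vec3 (x +i* y)%C (a +i* b)%C 1 in
  all_prop (fun x => absQ2 (vC R x) w = 1) J ->
  all_prop (fun x => 1 < absQ2 (vC R x) w) [seq x <- neighbours | x \notin iorbits J] ->
  realises w J.
Proof.
move=> hJ e1J e3J Q1 w HJ HN.
have FJ := all_propP HJ; have FN := all_propP HN; clear HJ HN.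
apply: (realises_e1_e3 hJ e1J e3J); rewrite absQ2_e1 nsq1; first by rewrite Qre_coords.
  exact: FJ.
by move=> z zn zJ; apply: FN; rewrite mem_filter zJ.
Qed.

Ltac realise J :=
  apply: realises_coords;
  [ by vm_compute | by vm_compute | by vm_compute
  | have := sqrt3_sqr; have /andP[] := sqrt3_bounds; move: sqrt3 => s s1 s2 ss; lra
  | do ?[split]; check_coords
  | let L := constr:([seq x <- neighbours | x \notin iorbits J]) in
    let L' := eval vm_compute in L in change L with L'; do ?[split]; check_coords ].

Lemma realises_J3_1 : realises (vec3 (1/2 +i* (sqrt3 / 2))%C (0 +i* 0)%C 1) iJ3_1.
Proof. realise iJ3_1. Qed.

(** The middle coordinate is chosen to give Q the value 24/25 - 7/25 i, of modulus 1, at (i, 1 + i,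
    1). *)
Lemma realises_J4_1 : realises (vec3 (1/2 +i* (sqrt3 / 2))%C
  ((13/100 + sqrt3 / 4) +i* (sqrt3 / 4 - 9/100))%C 1) iJ4_1.
Proof. realise iJ4_1. Qed.

Lemma realises_J5 : realises (vec3 (1/2 +i* (sqrt3 / 2))%C (1/2 +i* (1/2))%C 1) iJ5.
Proof. realise iJ5. Qed.

Definition sqrt2 : R := Num.sqrt 2.
Lemma sqrt2_sqr : sqrt2 * sqrt2 = 2.
Proof. by rewrite -expr2 sqr_sqrtr. Qed.
Lemma sqrt2_gt1 : 1 < sqrt2.
Proof.
by have := sqrt2_sqr; have := sqrtr_ge0 (2 : R); rewrite -/sqrt2; move: sqrt2 => s s0 ss; nra.
Qed.

(** As k^2 = 2, the left side of the inequality is A^2 + B^2 + k (A - B) + 1. *)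
Lemma J2_2_height (k : R) (A B : int) : k * k = 2 -> 1 < k -> B <= A ->
  (A%:~R + k / 2) ^+ 2 + (B%:~R - k / 2) ^+ 2 <= 1 -> A = 0 /\ B = 0.
Proof.
move=> kk k1; rewrite -(ler_int R) => AB H.
have {H} : (A * A + B * B)%:~R <= 0%:~R :> R.
  rewrite intrD !intrM; move: AB H; move: (A%:~R) (B%:~R) => a b AB.
  have k0 : 0 <= k by apply: ltW; apply: lt_trans k1.
  have : 0 <= k * (a - b) by rewrite mulr_ge0 ?subr_ge0.
  lra.
rewrite ler_int; clear; nia.
Qed.

(** Without (0, 0, 1) in the set, [neighbours] does not confine the search, and infinitely many
    translates must be excluded by hand. Here w lies in the span of the two vectors, so the pair
    bound is attained: Q(w, w) = sqrt(2) with F = 1. This leaves |q|^2 <= 2 for any competitor. *)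
Lemma realises_J2_2 : realises (vec3 (1/2 +i* ((1 + sqrt2) / 2))%C (1 +i* 0)%C 1) iJ2_2.
Proof.
set w := vec3 _ _ _; have kk := sqrt2_sqr; have k1 := sqrt2_gt1.
have Qk : Qre w = sqrt2 by rewrite Qre_coords; clear; lra.
have Qw : 0 < Qre w by rewrite Qk; clear - k1; lra.
have F1 : absQ2 (e1 R) w = 1 by rewrite absQ2_e1 nsq1.
have r2 x : x \in iJ2_2 -> reduced_isotropic (vC R x) by exact: reps_reduced.
apply: (realises_threshold Qw); first by vm_compute.
  move=> x xJ; split; first exact: r2.
  rewrite F1; move: xJ; rewrite !inE => /orP[] /eqP ->; first by rewrite vC_ie1 F1.
  rewrite absQ2_coords /=; move: kk; clear; move: sqrt2 => k kk; lra.
rewrite F1 => v rv Fv; have [iv Qv _] := rv; have [x ex] := gaussInt_vC iv.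
have r1 := reduced_isotropic_e1 R; have [_ Qe _] := r1.
have qx : nsq (hermQ (e1 R) v) = (inorm x.2)%:~R by rewrite ex -vC_ie1 iQP nsq_gC iQ_ie1.
have q2 : inorm x.2 <= 2.
  have := pair_bound Qe Qv Qw; rewrite qx F1 Qk expr2 kk mulr1.
  rewrite -(ler_int R); move: Fv; clear; move: (absQ2 v w) (_%:~R) => f N ff h.
  by rewrite -[2%:~R]/(2 : R); lra.
have [q0|q0] := eqVneq (inorm x.2) 0.
  have [|c uc ->] := isotropic_orth r1 rv; last by exists ie1 => //; exists c; rewrite // vC_ie1.
  by apply/eqP; rewrite -nsq_eq0 qx q0.
have [c [hc cF]] : exists c, c \in iunits /\ (gmul c x.2 = (1, 0) \/ gmul c x.2 = (1, 1)).
  have [q1|q1] := eqVneq (inorm x.2) 1.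
    by have [c hc ec] := unit_norm1 q1; exists c; split=> //; left.
  have [|c hc ec] := @unit_norm2 x.2; last by exists c; split=> //; right.
  have := inorm_ge0 x.2; move: q0 q1 q2; move: (inorm x.2) => n; clear; lia.
have uc : gunit (gC R c) by apply/gunitP; exists c.
have ru := reduced_isotropic_unit uc rv; rewrite {1}ex -vC_scale in ru.
have Fu : absQ2 (vC R (iscale c x)) w <= 1 by rewrite vC_scale -ex (absQ2_Zl _ _ (proj2 uc)).
have [Qx px] := reduced_isotropic_iprim ru.
suff e2 : iscale c x = ((0, 1), (1, 1), (1, 1)).
  have [uc' cc] := gunit_inv uc.
  exists ((0, 1), (1, 1), (1, 1)); first by vm_compute.
  by exists (gC R c)^* => //; rewrite -e2 vC_scale scalerA cc scale1r.
case: cF => cF; last first.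
  have [a [d [n [E _ _]]]] := itrans_J2_2 Qx cF px.
  move: Fu; rewrite E absQ2_coords /= => Fu.
  (* The difference of the two integers is (a - 1)^2 + d^2, so their vanishing forces a = 1 and d =
     0. *)
  have [||AB1 AB2] := @J2_2_height sqrt2 (n + a * a + d * d - a + d) (n + a + d - 1) kk k1.
  - by have := sqr_ge0 (a - 1); have := sqr_ge0 d; rewrite !expr2; clear; lia.
  - apply: le_trans Fu; rewrite le_eqVlt; apply/orP; left; apply/eqP.
    by rewrite !(intrD, intrN, intrM); congr (_ ^+ 2 + _ ^+ 2); field.
  have [a1 d0] : a = 1 /\ d = 0 by clear - AB1 AB2; nia.
  by rewrite a1 d0 (_ : n = 0) //; clear - AB2 a1 d0; lia.
have {}cF : (iscale c x).2 = (1, 0) := cF.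
move: Fu; case: (iscale c x) Qx cF => [[[m1 m2] [p1 p2]] q] /= [e _] cF.
(* By isotropy 2 (m2 - p1) = (p1 - 1)^2 + p2^2 - 1 >= -1, and the left side is even. *)
have np : 0 <= m2 - p1.
  move: e; rewrite cF /=; have := sqr_ge0 (p1 - 1); have := sqr_ge0 p2; rewrite !expr2.
  by clear; lia.
rewrite absQ2_coords cF /= leNgt => /negP[].
move: np; rewrite -(ler_int R) intrB; move: k1; clear.
move: sqrt2 (m1%:~R) (m2%:~R) (p1%:~R) (p2%:~R).
move=> k m n p p' k1 np; set X := (X in X ^+ 2 + _); set Y := (X in _ + X ^+ 2).
have X1 : 1 < X by rewrite /X; lra.
by have := sqr_ge0 Y; move: X1; clear; move: X Y => X Y; nra.
Qed.

Theorem reps_realised (J : seq ivec) : J \in ireps -> exists w, realises w J.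
Proof.
rewrite !inE => /or4P[/eqP->|/eqP->|/eqP->|/or4P[/eqP->|/eqP->|/eqP->|/or3P[]/eqP->]];
eexists; [exact: realises_J2_1|exact: realises_J2_2|exact: realises_J3_1|exact: realises_J3_2
|exact: realises_J3_3|exact: realises_J4_1|exact: realises_J4_2|exact: realises_J5
|exact: realises_J8].
Qed.

End Realisation.

(** * The symmetric space *)

Section SymmetricSpace.
Variable R : realType.
Local Notation C := R[i].
Implicit Types (g : 'M[C]_3) (u v w : 'cV[C]_3).

Lemma vec3Z (d a b c : C) : d *: vec3 a b c = vec3 (d * a) (d * b) (d * c).
Proof. by apply: cV3_eq; rewrite !mxE. Qed.

Lemma vec3_inj (a b c a' b' c' : C) :
  vec3 a b c = vec3 a' b' c' -> [/\ a = a', b = b' & c = c'].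
Proof.
by move=> /matrixP H; have := (H 0 0, H 1 0, H 2 0); rewrite !vec3E => -[[-> ->] ->].
Qed.

(** With v moved to (1, 0, 0), its stabiliser contains the central translation [itrans 0 0 1], and a
    line preserved by that translation has last coordinate 0. The other vector is therefore
    orthogonal to v. *)
Lemma line_stab_inj v v' : reduced_isotropic v -> reduced_isotropic v' ->
  line_stab v = line_stab v' -> exists2 c, gunit c & v' = c *: v.
Proof.
move=> rv rv' E; have [g Gg [c uc e]] := cusp_transitive rv.
have Sg := Gamma_SU21 Gg; have rgv := reduced_isotropic_act Gg rv'.
apply: (isotropic_orth rv rv'); rewrite -(SU21_hermQ _ _ Sg) e hermQZl hermQ_e1.
suff -> : (g *m v') 2 0 = 0 by rewrite !mulr0.
have Gt : Gamma (mC R (itrans 0 0 1)) by apply: Gamma_mC; apply: iGamma_trans.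
have : line_stab (g *m v') (mC R (itrans 0 0 1)).
  rewrite -(conjP_line_stab _ Sg) -E (conjP_line_stab _ Sg) e line_stab_scale ?gunit_neq0 //.
  by split; [exact: Gamma_SU21 | exists 1; rewrite trans_vec3 !mulr0 !addr0 scale1r].
move: (g *m v') => x [_ [d]].
rewrite -[x]vec3_id trans_vec3 vec3Z vec3E => /vec3_inj[h1 _ h2].
have [//|q0] := eqVneq (x 2 0) 0.
have d1 : d = 1 by apply: (mulIf q0); rewrite -h2 mul1r.
move: h1; rewrite d1 mul1r (_ : gC R (0 - 0, 0 + 0) = 0) // mul0r addr0.
by rewrite (_ : gC R _ = 1) // mul1r => /eqP; rewrite -subr_eq0 addrAC subrr add0r => /eqP.
Qed.

Lemma vecP_line_stab v : reduced_isotropic v ->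
  exists2 c, gunit c & vecP (line_stab v) = c *: v.
Proof.
move=> rv; rewrite /vecP; case: xgetP => [u _ [ru E]|/(_ v) []//].
exact: line_stab_inj.
Qed.

(** The image under u a of the positive vector [w0], whose line K fixes, rescaled to last coordinate
    1. *)
Definition point (y : R) (beta : C) (r : R) : 'cV[C]_3 :=
  vec3 (r%:C%C + 'i * (y ^+ 2 + nsq beta / 2)%:C%C) ('i * beta^*) 1.

Definition w0 : 'cV[C]_3 := vec3 'i 0 1.

Lemma hermQ_e3 v : hermQ (e3 R) v = - 'i * v 0 0.
Proof. by rewrite hermQE !vec3E rmorph1 rmorph0; ring. Qed.

(** If F vanished at v, the pair bound would make v orthogonal to both (1, 0, 0) and (0, 0, 1),
    hence zero. *)
Lemma absQ2_gt0 v w : reduced_isotropic v -> 0 < Qre w -> 0 < absQ2 v w.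
Proof.
move=> rv Qw; have [_ Qv _] := rv; rewrite lt_def absQ2_ge0 andbT; apply/eqP => F0.
have orth x : reduced_isotropic (vC R x) -> hermQ (vC R x) v = 0.
  move=> [_ Qx _]; have := pair_bound Qx Qv Qw; rewrite F0 mulr0 => h.
  apply/eqP; rewrite -nsq_eq0; apply/eqP/le_anti; rewrite nsq_ge0 andbT.
  by rewrite -(ler_pM2r (exprn_gt0 2 Qw)) mul0r.
have q0 : v 2 0 = 0.
  have := orth ie1; rewrite vC_ie1 hermQ_e1 => /(_ (reduced_isotropic_e1 R)) /eqP.
  by rewrite mulf_eq0 -(nsq_eq0 'i) nsq_i oner_eq0 /= => /eqP.
have n0 : v 0 0 = 0.
  have r3 : reduced_isotropic (vC R ie3) by apply: reduced_isotropic_vC.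
  have := orth ie3 r3; rewrite vC_ie3 hermQ_e3 => /eqP.
  by rewrite mulf_eq0 oppr_eq0 -(nsq_eq0 'i) nsq_i oner_eq0 /= => /eqP.
have := isotropic_q0 Qv q0; rewrite n0.
by rewrite scale0r => v0; have := reduced_isotropic_neq0 rv; rewrite v0 eqxx.
Qed.

Lemma Qre_point y beta r : Qre (point y beta r) = 2 * y ^+ 2.
Proof.
by case: beta => a b; rewrite /Qre /point hermQ_vec3 iE /nsq /=; field.
Qed.

Lemma normC_sqr (z : C) : `|z| ^+ 2 = (nsq z)%:C%C.
Proof. by rewrite normCK mulrC nsqE. Qed.

Lemma half_realC (x : R) : x%:C%C / 2 = (x / 2)%:C%C.
Proof. by rewrite rmorphM fmorphV rmorph_nat. Qed.

Lemma exhaustion_point (z : set 'M[C]_3) y beta r v :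
  reduced_isotropic v -> coords z = (y, beta, r) ->
  exhaustion (line_stab v) z = y / Num.sqrt (absQ2 v (point y beta r)).
Proof.
move=> rv E; have [c uc ev] := vecP_line_stab rv; rewrite /exhaustion E.
rewrite -(absQ2_Zl v _ (proj2 uc)) -ev.
have [_ + _] : reduced_isotropic (vecP (line_stab v)).
  by rewrite ev; apply: reduced_isotropic_unit.
move: (vecP _) => {v rv c uc ev E} v; rewrite -[v]vec3_id !vec3E.
move=> /isotropic_vec3; rewrite /absQ2 !normc_nsq /point hermQ_vec3 => iso.
congr (_ / Num.sqrt _); rewrite normC_sqr -mulrA half_realC.
move: (v 0 0) (v 1 0) (v 2 0) iso => [n1 n2] [p1 p2] [q1 q2].
case: beta => [a b]; rewrite iE /nsq /= => iso.
apply/eqP; rewrite -subr_eq0; apply/eqP.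
(* The two radicands differ by y^2 times the isotropy relation of v. *)
transitivity (y ^+ 2 * (p1 ^+ 2 + p2 ^+ 2 - 2 * (n2 * q1 - n1 * q2))).
  by field.
by rewrite iso subrr mulr0.
Qed.

Lemma umx_amx_w0 y beta r : y != 0 ->
  (umx beta r *m amx y) *m w0 = (y^-1)%:C%C *: point y beta r.
Proof.
move=> y0; rewrite /w0 -mulmxA !mulmx_vec3 !mxE /= /point vec3Z.
rewrite normC_sqr -mulrA half_realC iE.
have yy : y^-1 * y ^+ 2 = y by rewrite expr2 mulKf.
move: (nsq beta) => N; case: beta => [a b]; congr vec3; apply/eqP; rewrite eq_complex /=;
  apply/andP; split; apply/eqP; rewrite ?mulrDr ?yy; move: (y^-1) yy => k yy; try ring.
by rewrite -[in LHS]yy; ring.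
Qed.

Definition cols3 (a b c : 'cV[C]_3) : 'M[C]_3 := \matrix_(i, j) (nth 0 [:: a; b; c] j) i 0.

Lemma cols3_form (a b c : 'cV[C]_3) i j :
  ((cols3 a b c) ^t* *m Hmx R *m cols3 a b c) i j
    = hermQ (nth 0 [:: a; b; c] i) (nth 0 [:: a; b; c] j).
Proof.
rewrite /hermQ !mxE; apply: eq_bigr => k _; rewrite !mxE /=; congr (_ * _).
by apply: eq_bigr => l _; rewrite !mxE.
Qed.

Lemma SU21_cols3 (a b c : 'cV[C]_3) : \det (cols3 a b c) = 1 ->
  hermQ a a = 0 -> hermQ a b = 0 -> hermQ a c = 'i -> hermQ b b = -1 -> hermQ b c = 0 ->
  hermQ c c = 0 -> SU21 (cols3 a b c).
Proof.
move=> d1 aa ab ac bb bc cc; split=> //.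
have ba : hermQ b a = 0 by rewrite -hermQC ab rmorph0.
have cb : hermQ c b = 0 by rewrite -hermQC bc rmorph0.
have ca : hermQ c a = - 'i by rewrite -hermQC ac conj_i.
by apply: M3_eq => j; rewrite cols3_form; case: (ord3_cases j) => -> /=;
  rewrite mxE /= ?(aa, ab, ac, ba, bb, bc, ca, cb, cc).
Qed.

Lemma SU21_amx (y : R) : y != 0 -> SU21 (amx y).
Proof.
move=> y0; have -> : amx y = cols3 (vec3 y%:C%C 0 0) (vec3 0 1 0) (vec3 0 0 (y^-1)%:C%C).
  by apply: M3_eq => j; case: (ord3_cases j) => ->; rewrite !mxE /= ?mxE.
have yy : y%:C%C * (y^-1)%:C%C = 1 :> C by rewrite -rmorphM mulfV.
have yc : (y%:C%C)^* = y%:C%C :> C by apply/eqP; rewrite eq_complex /= oppr0 !eqxx.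
apply: SU21_cols3;
  rewrite ?hermQ_vec3 ?rmorph0 ?rmorph1 ?yc ?(mulr0, mul0r, subr0, sub0r, oppr0) //.
- by rewrite det3 !mxE /= ?mxE /= !(mulr0, mul0r, subr0, sub0r, addr0, mul1r) yy.
- by rewrite -mulrA yy mulr1.
- by rewrite mulr1.
Qed.

Lemma SU21_umx (beta : C) (r : R) : SU21 (umx beta r).
Proof.
have -> : umx beta r = cols3 (vec3 1 0 0) (vec3 beta 1 0)
    (vec3 (r%:C%C + 'i * (nsq beta / 2)%:C%C) ('i * beta^* ) 1).
  by apply: M3_eq => j; case: (ord3_cases j) => ->;
     rewrite !mxE /= ?mxE //= normC_sqr -mulrA half_realC.
apply: SU21_cols3;
  rewrite ?hermQ_vec3 ?rmorph0 ?rmorph1 ?(mulr0, mul0r, subr0, sub0r, mulr1, mul1r, oppr0) //.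
- by rewrite det3 !mxE /= ?mxE /=; ring.
- by rewrite subrr.
case: beta => [a b]; rewrite /nsq iE.
by apply/eqP; rewrite eq_complex /=; apply/andP; split; apply/eqP; field.
Qed.

Lemma Hmx_w0 : Hmx R *m w0 = w0.
Proof.
have ii : 'i * 'i = -1 :> C by rewrite -expr2 sqrCi.
rewrite /w0 mulmx_vec3 !mxE /=; congr vec3; rewrite ?(mulr0, mul0r, add0r, addr0, mulr1) //.
by rewrite mulNr ii opprK.
Qed.

Lemma form_w0 : w0 *m w0 ^t* - Hmx R = 1%:M.
Proof.
have ii : 'i * 'i = -1 :> C by rewrite -expr2 sqrCi.
apply: M3_eq => j; rewrite !mxE big_ord_recl big_ord0 addr0 !mxE /=;
  case: (ord3_cases j) => -> /=;
  by rewrite ?conj_i ?rmorph0 ?rmorph1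
    ?(mulr0, mul0r, mulr1, mul1r, subr0, sub0r, mulrN, ii, opprK, subrr, addNr, oppr0).
Qed.

(* The unitary form is w0 w0* - H, so an element of SU(2,1) is unitary as soon as it
   preserves the line of w0. *)
Lemma maxK_w0 (k : 'M[C]_3) : maxK k <-> SU21 k /\ exists2 c, nsq c = 1 & k *m w0 = c *: w0.
Proof.
have Q2 : Qre w0 = 2 by rewrite /Qre hermQ_vec3 iE /=; ring.
split=> [[Sk kk]|[Sk [c c1 kw]]]; split; try exact: Sk.
  have Uk := SU21_unit Sk; have [_ kH] := Sk.
  have kk1 : k ^t* *m k = 1%:M.
    by rewrite -{2}kk mulmxV // map_unitmx unitmx_tr.
  have kkV : k *m k ^t* = 1%:M by apply: mulmx1C.
  have kHk : Hmx R *m k = k *m Hmx R by rewrite -[in RHS]kH !mulmxA kkV mul1mx.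
  (* A unitary k in SU(2,1) commutes with H, and [w0] spans the eigenspace of H for the eigenvalue
     1. *)
  have : Hmx R *m (k *m w0) = k *m w0 by rewrite mulmxA kHk -mulmxA Hmx_w0.
  have : Qre (k *m w0) = 2 by rewrite (Qre_act _ Sk).
  move: (k *m w0) => v Qv Hv.
  have ha : (Hmx R *m v) 0 0 = v 0 0 by rewrite Hv.
  have hb : (Hmx R *m v) 1 0 = v 1 0 by rewrite Hv.
  move: ha hb; rewrite !mxE !sum3 !mxE /= ?(mul0r, add0r, addr0) => ha hb.
  have b0 : v 1 0 = 0.
    have : v 1 0 *+ 2 = 0 by rewrite mulr2n -{1}hb mulN1r addNr.
    by move/eqP; rewrite mulrn_eq0 /= => /eqP.
  have Ev : v = v 2 0 *: w0.
    by rewrite -{1}[v]vec3_id /w0 vec3Z -ha b0 mulr0 mulr1 mulrC.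
  exists (v 2 0); last exact: Ev.
  by have := congr1 (@Qre R) Ev; rewrite Qv Qre_Z Q2; move: (nsq _) => n; clear; lra.
have Uk := SU21_unit Sk; have [_ kH] := Sk.
have kiw : invmx k *m w0 = c^* *: w0.
  by rewrite -[LHS]scale1r -[1]/((1 : R)%:C%C) -c1 -nsqE -scalerA scalemxAr -kw mulKmx.
have kcw : k ^t* *m w0 = c^* *: w0.
  rewrite -{1}Hmx_w0 mulmxA -[_ *m Hmx R]mulmx1 -(mulmxV Uk) !mulmxA kH -mulmxA kiw.
  by rewrite -scalemxAr Hmx_w0.
have kk : k ^t* *m k = 1%:M.
  rewrite -[X in X *m k]mulmx1 -form_w0 mulmxBr mulmxBl kH mulmxA kcw -mulmxA.
  have -> : w0 ^t* *m k = c *: w0 ^t*.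
    rewrite -[LHS]trmxCK trmx_mul map_mxM trmxCK kcw.
    by apply/matrixP => i j; rewrite !mxE rmorphM /= conjCK.
  by rewrite -scalemxAl -scalemxAr scalerA nsqE c1 scale1r.
have Ukc : k ^t* \in unitmx by rewrite map_unitmx unitmx_tr.
by rewrite -[LHS]mulmx1 -kk mulKmx.
Qed.

Lemma maxK_1 : maxK (1%:M : 'M[C]_3).
Proof. by split; [exact: SU21_1 | rewrite trmx1 map_mx1 invmx1]. Qed.

Lemma maxK_mul (k l : 'M[C]_3) : maxK k -> maxK l -> maxK (k *m l).
Proof.
move=> /maxK_w0[Sk [c c1 kw]] /maxK_w0[Sl [d d1 lw]]; apply/maxK_w0.
split; first exact: SU21_mul.
by exists (d * c); rewrite ?nsqM ?c1 ?d1 ?mulr1 // -mulmxA lw -scalemxAr kw scalerA.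
Qed.

Lemma maxK_inv (k : 'M[C]_3) : maxK k -> maxK (invmx k).
Proof.
move=> /maxK_w0[Sk [c c1 kw]]; apply/maxK_w0; split; first exact: SU21_invmx.
exists c^*; first by rewrite nsq_conj.
have cc : c^* * c = 1 by rewrite nsqE c1.
by rewrite -[in LHS](scale1r w0) -cc -scalerA -kw -scalemxAr mulKmx // SU21_unit.
Qed.

Lemma cosetKP g h : cosetK g = cosetK h <-> exists2 k, maxK k & h = g *m k.
Proof.
split=> [E|[k Kk ->]].
  have : cosetK g h by rewrite E; exists 1%:M; [exact: maxK_1 | rewrite mulmx1].
  by move=> [k Kk <-]; exists k.
apply/seteqP; split=> _ [l Kl <-].
  exists (invmx k *m l); first by apply: maxK_mul => //; apply: maxK_inv.
  by rewrite -mulmxA mulKVmx //; apply: SU21_unit; case: Kk.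
by exists (k *m l); [exact: maxK_mul | rewrite mulmxA].
Qed.

Lemma point_surj w : 0 < Qre w -> exists c y beta r,
  [/\ 0 < y, c != 0 & w = c *: point y beta r].
Proof.
move=> Qw; have w20 := minvec_Qre_neq0 Qw; have := Qw; rewrite (vec3_normalise w20) Qre_Z.
rewrite pmulr_rgt0 ?nsq_gt0 //.
move: (w 0 0 / w 2 0) (w 1 0 / w 2 0) => [x t] [a b]; rewrite Qre_coords => h.
pose y2 := t - (a ^+ 2 + b ^+ 2) / 2.
have y2p : 0 < y2 by rewrite /y2; lra.
(* The middle coordinate of [point] is i times the conjugate of beta, which interchanges real and
   imaginary parts. *)
exists (w 2 0), (Num.sqrt y2), (b +i* a)%C, x; split; [by rewrite sqrtr_gt0 | exact: w20 |].
congr (_ *: vec3 _ _ _); rewrite ?sqr_sqrtr ?(ltW y2p) // iE;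
  apply/eqP; rewrite eq_complex /nsq /y2 /=; apply/andP; split; apply/eqP; by field.
Qed.

(** The vector g w0 is positive, hence a multiple of some [point], that is, of u a w0. Then (u a)^-1
    g preserves the line of [w0] and lies in K. *)
Lemma Iwasawa g : SU21 g -> exists y beta r,
  0 < y /\ cosetK g = cosetK (umx beta r *m amx y).
Proof.
move=> Sg; have Q2 : Qre w0 = 2 by rewrite /Qre hermQ_vec3 iE /=; ring.
have Qg : Qre (g *m w0) = 2 by rewrite Qre_act.
have [|c [y [beta [r [y0 c0 E]]]]] := @point_surj (g *m w0); first by rewrite Qg.
have yn : y != 0 by rewrite gt_eqF.
exists y, beta, r; split=> //; set h := umx beta r *m amx y.
have Sh : SU21 h by apply: SU21_mul; [exact: SU21_umx | exact: SU21_amx].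
have yy : y%:C%C * (y^-1)%:C%C = 1 :> C by rewrite -rmorphM mulfV.
have hw : h *m w0 = (y^-1)%:C%C *: point y beta r by apply: umx_amx_w0.
have kw : invmx h *m g *m w0 = (c * y%:C%C) *: w0.
  rewrite -mulmxA E -[point _ _ _]scale1r -yy -[in LHS]scalerA -hw.
  by rewrite -!scalemxAr mulKmx ?SU21_unit // scalerA.
apply/esym/cosetKP; exists (invmx h *m g); last by rewrite mulKVmx // SU21_unit.
have Sk : SU21 (invmx h *m g) by apply: SU21_mul => //; apply: SU21_invmx.
apply/maxK_w0; split; first exact: Sk.
exists (c * y%:C%C); last exact: kw.
by have := Qre_act w0 Sk; rewrite kw Qre_Z Q2; move: (nsq _) => n; clear; lra.
Qed.

(** Equality of the points is all that is recorded, because exhaustion functions are compared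
    through [point]. *)
Lemma coords_cosetK y beta r : 0 < y -> exists y' beta' r',
  [/\ coords (cosetK (umx beta r *m amx y)) = (y', beta', r'), 0 < y' &
      point y' beta' r' = point y beta r].
Proof.
move=> y0; rewrite /coords; case: xgetP => [[[y' beta'] r'] _ [y'0 /cosetKP[k Kk E]]|]; last first.
  by move=> /(_ (y, beta, r)) [].
exists y', beta', r'; split=> //.
have [_ [c c1 kw]] := (maxK_w0 k).1 Kk.
have [yn yn'] : y != 0 /\ y' != 0 by rewrite !gt_eqF.
have := umx_amx_w0 beta' r' yn'; rewrite E -mulmxA kw -scalemxAr umx_amx_w0 // scalerA.
rewrite /point !vec3Z !mulr1 => /vec3_inj[e1 e2 e3].
have c0 : (c * (y^-1)%:C%C) != 0.
  by rewrite e3 -nsq_eq0 /nsq /= expr0n addr0 sqrf_eq0 invr_eq0.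
by rewrite -e3 in e1 e2; rewrite (mulfI c0 e1) (mulfI c0 e2).
Qed.

Lemma coords_symD (z : set 'M[C]_3) : symD z -> exists y beta r, coords z = (y, beta, r) /\ 0 < y.
Proof.
move=> [g Sg <-]; have [y [beta [r [y0 ->]]]] := Iwasawa Sg.
by have [y' [b' [r' [E y'0 _]]]] := coords_cosetK beta r y0; exists y', b', r'.
Qed.

Lemma Qre_point_gt0 y beta r : 0 < y -> 0 < Qre (point y beta r).
Proof. by move=> y0; rewrite Qre_point mulr_gt0 ?exprn_gt0. Qed.

Lemma exhaustion_le (z : set 'M[C]_3) y beta r u v : coords z = (y, beta, r) -> 0 < y ->
  reduced_isotropic u -> reduced_isotropic v ->
  (exhaustion (line_stab u) z <= exhaustion (line_stab v) z)
   = (absQ2 v (point y beta r) <= absQ2 u (point y beta r)).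
Proof.
move=> E y0 ru rv; rewrite (exhaustion_point ru E) (exhaustion_point rv E).
have Qp := Qre_point_gt0 beta r y0; have Fu := absQ2_gt0 ru Qp; have Fv := absQ2_gt0 rv Qp.
rewrite (ler_pM2l y0); move: (absQ2 u _) (absQ2 v _) Fu Fv => a b a0 b0.
by rewrite lef_pV2 ?posrE ?sqrtr_gt0 // ler_sqrt // ltW.
Qed.

Lemma domP_minvec (z : set 'M[C]_3) y beta r v : symD z -> coords z = (y, beta, r) -> 0 < y ->
  reduced_isotropic v -> domP (line_stab v) z <-> minvec (point y beta r) v.
Proof.
move=> Dz E y0 rv; split=> [[_ H]|[_ H]].
  split; first exact: rv.
  move=> u ru; have [e|ne] := pselect (line_stab u = line_stab v).
    by have [c [_ c1] ->] := line_stab_inj ru rv e; rewrite absQ2_Zl.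
  by rewrite -(exhaustion_le E y0 ru rv); apply: H => //; exists u.
by split=> // _ [u ru <-] _; rewrite (exhaustion_le E y0 ru rv); apply: H.
Qed.

Definition min_parabolics w : set (set 'M[C]_3) := [set line_stab v | v in minvec w].

Lemma min_parabolicsP w v : reduced_isotropic v -> min_parabolics w (line_stab v) <-> minvec w v.
Proof.
move=> rv; split=> [[u mu e]|mv]; last by exists v.
have [c uc ->] := line_stab_inj (proj1 mu) rv e.
exact: (proj2 (minvec_unit w u uc)).
Qed.

Lemma strongly_admissibleP (I : set (set 'M[C]_3)) : I !=set0 ->
  strongly_admissible I <-> exists2 w, 0 < Qre w & I = min_parabolics w.
Proof.
move=> [P0 IP0]; split.
  move=> [IP [z [[Dz domI_z] maxI]]]; have [y [beta [r [E y0]]]] := coords_symD Dz.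
  exists (point y beta r); first exact: Qre_point_gt0.
  apply/seteqP; split=> [P IPP|_ [v mv <-]].
    have [v rv e] := IP P IPP; have := domI_z P IPP; rewrite -{}e => Pz.
    exact: (proj2 (min_parabolicsP _ rv) (proj1 (domP_minvec Dz E y0 rv) Pz)).
  (* A minimal parabolic outside I could be adjoined to I, which would put z in the D of a strictly
     larger set. *)
  apply: contrapT => nI; apply: maxI; exists (I `|` [set line_stab v]); last first.
    split=> // P [/domI_z //| ->].
    exact: (proj2 (domP_minvec Dz E y0 (proj1 mv)) mv).
  split; first by move=> P [/IP //| ->]; exists v => //; exact: (proj1 mv).
  by split=> [|H]; [apply: subsetUl | apply: nI; apply: H; right].
move=> [w Qw EI]; split.
  by rewrite EI => _ [v mv <-]; exists v => //; exact: (proj1 mv).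
have [c [y [beta [r [y0 c0 Ew]]]]] := point_surj Qw.
have [y' [beta' [r' [E y'0 Ep]]]] := coords_cosetK beta r y0.
set z := cosetK _ in E.
have Dz : symD z.
  exists (umx beta r *m amx y) => //.
  by apply: SU21_mul; [exact: SU21_umx | apply: SU21_amx; rewrite gt_eqF].
have mE v : minvec w v <-> minvec (point y' beta' r') v by rewrite Ep Ew; exact: minvecZ.
exists z; split.
  split=> // P; rewrite EI => -[v mv <-].
  apply: (proj2 (domP_minvec Dz E y'0 (proj1 mv))); exact: (proj1 (mE v)).
move=> [I' [I'P [II' nI']] [_ HI']]; apply: nI' => P I'PP.
have [v rv e] := I'P P I'PP; have := HI' P I'PP; rewrite -{}e EI => Pz.
apply: (proj2 (min_parabolicsP _ rv)); apply: (proj2 (mE v)).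
exact: (proj1 (domP_minvec Dz E y'0 rv) Pz).
Qed.

End SymmetricSpace.

(** * Invariants of the list *)

Definition idet3 (a b c : ivec) : int := inorm (idet (a, b, c)).

(* Backtracking search for a map from J to J' preserving the |Q(a, b)|^2 and the
   |det(a, b, c)|^2; A is the graph of the map on the vectors already treated. *)
Definition extends (A : seq (ivec * ivec)) (a a' : ivec) : bool :=
  all (fun p => (inorm (iQ p.2 a') == inorm (iQ p.1 a)) &&
    all (fun q => idet3 p.2 q.2 a' == idet3 p.1 q.1 a) A) A.

Fixpoint embeds (A : seq (ivec * ivec)) (J J' : seq ivec) : bool :=
  if J is a :: J1 then
    short_has (fun a' => if extends A a a' then embeds ((a, a') :: A) J1 J' else false) J'
  else true.

(** Both directions are required: J2_1, for one, embeds in J3_1. *)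
Lemma ireps_not_isomorphic :
  all (fun J => all (fun J' => (embeds [::] J J' && embeds [::] J' J) ==> (J == J')) ireps) ireps.
Proof. by vm_compute. Qed.

(** The search cannot miss an existing map, since [f a] is an admissible choice at every step. In
    the induction J shrinks and S grows inside a fixed K. *)
Lemma embeds_map (f : ivec -> ivec) (K J J' S : seq ivec) :
  {subset J <= K} -> {subset S <= K} -> {in K, forall a, f a \in J'} ->
  {in K &, forall a b, inorm (iQ (f a) (f b)) = inorm (iQ a b)} ->
  {in K & K & K, forall a b c, idet3 (f a) (f b) (f c) = idet3 a b c} ->
  embeds [seq (a, f a) | a <- S] J J'.
Proof.
move=> + + fJ' fQ fd; elim: J S => [//|a J IH] S JK SK; rewrite [embeds _ _ _]/= short_hasP.
have aK : a \in K by apply: JK; rewrite inE eqxx.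
apply/hasP; exists (f a); first exact: fJ'.
have -> : extends [seq (x, f x) | x <- S] a (f a).
  apply/allP => _ /mapP[x /SK xK ->] /=; rewrite fQ // eqxx /=.
  by apply/allP => _ /mapP[y /SK yK ->] /=; rewrite fd // eqxx.
apply: (IH (a :: S)) => x; first by move=> xJ; apply: JK; rewrite inE xJ orbT.
by rewrite inE => /orP[/eqP ->|/SK].
Qed.

(** * Conjugacy of the representatives and the conclusion *)

Section Main.
Variable R : realType.
Local Notation C := R[i].
Implicit Types (g : 'M[C]_3) (u v w : 'cV[C]_3).

Lemma representativesE : representatives R = [seq [seq vC R x | x <- L] | L <- ireps].
Proof.
have i0 : gC R (0, 1) = 'i := gCi R.
have ii : gC R (1, 1) = 1 + 'i by rewrite -gC1 -i0 -gC_add.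
have Ni : gC R (-1, 1) = -1 + 'i by rewrite -gCN1 -i0 -gC_add.
have iN : gC R (1, -1) = 1 - 'i by rewrite -gC1 -i0 -gC_opp -gC_add.
have two : gC R (2, 0) = 2 by rewrite -[LHS]/(gC R (gadd (1, 0) (1, 0))) gC_add !gC1.
have i2 : gC R (0, 2) = 2 * 'i by rewrite -i0 -two -gC_mul.
by rewrite /representatives /J8 /J5 /J4_1 /J4_2 /J3_1 /J3_2 /J3_3 /J2_1 /J2_2
  /= /vC /= i0 ii Ni iN two i2 !gC0 !gC1 !gCN1.
Qed.

Lemma conj_parabolics_of g (L : seq ivec) : Gamma g ->
  [set conjP g P | P in parabolics_of [seq vC R x | x <- L]]
  = [set line_stab (g *m vC R x) | x in [set` L]].
Proof.
move=> Gg; have Sg := Gamma_SU21 Gg; apply/seteqP; split.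
  move=> _ [_ [_ /mapP[x xL ->] <-] <-]; exists x; first exact: xL.
  by rewrite conjP_line_stab.
move=> _ [x xL <-]; exists (line_stab (vC R x)); last by rewrite conjP_line_stab.
by exists (vC R x) => //; apply/mapP; exists x.
Qed.

Lemma min_parabolics_type w g (L : seq ivec) : Gamma g ->
  (forall v, minvec w (g *m v) <-> unit_multiples L v) ->
  min_parabolics w = [set line_stab (g *m vC R x) | x in [set` L]].
Proof.
move=> Gg H; apply/seteqP; split.
  move=> _ [v mv <-]; have : minvec w (g *m (invmx g *m v)) by rewrite (Gamma_KV v Gg).
  move=> /H[x xL [c uc e]]; exists x; first exact: xL.
  by rewrite -[v](Gamma_KV v Gg) e -scalemxAr line_stab_scale // gunit_neq0.
move=> _ [x xL <-]; exists (g *m vC R x); last by [].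
apply: (proj2 (H _)); exists x; first exact: xL.
by exists 1; [exact: gunit1 | rewrite scale1r].
Qed.

Lemma card_ge2 (T : Type) (I : set (set T)) :
  `I_2 #<= I <-> exists P Q, [/\ I P, I Q & P <> Q].
Proof.
split=> [/pcard_leP/injfunPex[f fI finj]|[P [Q [IP IQ PQ]]]].
  exists (f 0%N), (f 1%N); split; [exact: fI | exact: fI |].
  by move=> /(finj 0%N 1%N) /= e; have := e (mem_set isT) (mem_set isT).
apply/pcard_leP/injfunPex; exists (fun n => if n == 0%N then P else Q).
  by move=> [|n] _.
move=> n m; rewrite !inE /=.
by case: n m => [|[|n]] [|[|m]] //= _ _ e; case: PQ.
Qed.

(** The explicit points enter here: a conjugate of a listed set is the set of minimal parabolics at
    the translated point. *)
Lemma Gamma_conjugateP (L : seq ivec) (I : set (set 'M[C]_3)) : L \in ireps ->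
  Gamma_conjugate (parabolics_of [seq vC R x | x <- L]) I <->
  exists2 w, 0 < Qre w & I = min_parabolics w /\ has_type w L.
Proof.
move=> hL; split=> [[g Gg]|[w Qw [EI [g Gg H]]]]; last first.
  by exists g; rewrite // conj_parabolics_of // EI; apply/esym/min_parabolics_type.
rewrite conj_parabolics_of // => <-; have [w [Qw H]] := reps_realised R hL.
have Hg v : minvec (g *m w) (g *m v) <-> unit_multiples L v.
  by rewrite -H; apply: iff_trans (minvec_actE _ _ Gg) _; rewrite (Gamma_K v Gg).
exists (g *m w); first by rewrite (Qre_act w (Gamma_SU21 Gg)).
split; last by exists g.
exact/esym/min_parabolics_type.
Qed.

Definition nonproportional_pair (L : seq ivec) : bool :=
  has (fun x => has (fun y => iQ x y != (0, 0)) L) L.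

Lemma ireps_nonproportional : all nonproportional_pair ireps.
Proof. by vm_compute. Qed.

Lemma hermQ_unit_multiple (c d : C) u v : gunit c -> gunit d ->
  nsq (hermQ (c *: u) (d *: v)) = nsq (hermQ u v).
Proof. by move=> [_ c1] [_ d1]; rewrite hermQZl hermQZr !nsqM nsq_conj c1 d1 !mul1r. Qed.

Lemma conjugate_embeds (L L' : seq ivec) : L \in ireps -> L' \in ireps ->
  Gamma_conjugate (parabolics_of [seq vC R x | x <- L]) (parabolics_of [seq vC R x | x <- L']) ->
  embeds [::] L L'.
Proof.
move=> hL hL' [g Gg]; rewrite conj_parabolics_of // => E.
pose image x x' := exists2 c, gunit c & g *m vC R x = c *: vC R x'.
have exi x : x \in L -> exists2 x', x' \in L' & image x x'.
  move=> xL; have : [set line_stab (g *m vC R x) | x in [set` L]] (line_stab (g *m vC R x)).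
    by exists x.
  rewrite E => -[_ /mapP[x' x'L ->] e]; exists x' => //.
  apply: (line_stab_inj (reps_reduced R hL' x'L) _ e).
  by apply: (reduced_isotropic_act Gg); apply: (reps_reduced R hL xL).
pose f x := nth ie1 L' (find (fun x' => `[< image x x' >]) L').
have fP x : x \in L -> f x \in L' /\ image x (f x).
  move=> /exi[x' x'L ix]; have hx : has (fun x' => `[< image x x' >]) L'.
    by apply/hasP; exists x' => //; apply/asboolP.
  by split; [rewrite mem_nth // -has_find | apply/asboolP/(nth_find ie1 hx)].
apply: (@embeds_map f L L L' [::]) => //.
- by move=> a /fP[].
- move=> a b /fP[_ [c uc ea]] /fP[_ [d ud eb]].
  apply/eqP; rewrite -(eqr_int R) -!nsq_gC -!iQP -(hermQ_unit_multiple _ _ uc ud) -ea -eb.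
  by rewrite (SU21_hermQ _ _ (Gamma_SU21 Gg)).
move=> a b c /fP[_ [k [_ k1] ea]] /fP[_ [l [_ l1] eb]] /fP[_ [m [_ m1] ec]].
apply/eqP; rewrite -(eqr_int R) -!nsq_gC -!det_mC; apply/eqP.
have dg : \det g = 1 by case: (Gamma_SU21 Gg).
(* g carries a, b, c to unit multiples of their images, so the two determinants differ by the unit k
   l m. *)
pose D : 'rV[C]_3 := \row_j nth 0 [:: k; l; m] j.
have : g *m mC R (a, b, c) = mC R (f a, f b, f c) *m diag_mx D.
  apply/matrixP => i j; rewrite mul_mx_diag !mxE.
  have entry x y z : g *m vC R x = z *: vC R y ->
      \sum_j g i j * vC R x j 0 = vC R y i 0 * z.
    by move=> /matrixP/(_ i 0); rewrite !mxE mulrC.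
  by case: (ord3_cases j) => -> /=; rewrite -?(entry _ _ _ ea) -?(entry _ _ _ eb)
    -?(entry _ _ _ ec); apply: eq_bigr => s _; rewrite mxE.
move=> /(congr1 (fun A => nsq (\det A))); rewrite !det_mulmx dg mul1r nsqM det_diag.
by rewrite !big_ord_recl big_ord0 mulr1 !mxE /= !nsqM k1 l1 m1 !mulr1 => ->.
Qed.

Lemma Gamma_conjugate_sym (I I' : set (set 'M[C]_3)) :
  I `<=` @parabolics R -> Gamma_conjugate I I' -> Gamma_conjugate I' I.
Proof.
move=> IP [h Gh <-]; have Gi := Gamma_inv Gh; exists (invmx h); first exact: Gi.
have K P : I P -> conjP (invmx h) (conjP h P) = P.
  move=> /IP[v rv <-]; rewrite (conjP_line_stab _ (Gamma_SU21 Gh)).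
  by rewrite (conjP_line_stab _ (Gamma_SU21 Gi)) (Gamma_K _ Gh).
apply/seteqP; split=> [_ [_ [P IPP <-] <-]|P IPP]; first by rewrite K.
by exists (conjP h P); [exists P | rewrite K].
Qed.

Lemma parabolics_of_reps (L : seq ivec) : L \in ireps ->
  parabolics_of [seq vC R x | x <- L] `<=` @parabolics R.
Proof.
by move=> hL _ [_ /mapP[x xL ->] <-]; exists (vC R x) => //; apply: (reps_reduced R hL xL).
Qed.

End Main.

Theorem theorem6p6 (R : realType) :
  (forall I : set (set 'M[R[i]]_3),
     (strongly_admissible I /\ `I_2 #<= I) <->
     (exists2 J, J \in representatives R &
        Gamma_conjugate (parabolics_of J) I)) /\
  (forall J J', J \in representatives R -> J' \in representatives R ->
     Gamma_conjugate (parabolics_of J) (parabolics_of J') -> J = J').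
Proof.
rewrite representativesE; split=> [I|_ _ /mapP[L hL ->] /mapP[L' hL' ->] H]; last first.
  have E1 := conjugate_embeds hL hL' H.
  have E2 := conjugate_embeds hL' hL (Gamma_conjugate_sym (parabolics_of_reps hL) H).
  by have := allP (allP ireps_not_isomorphic L hL) L' hL'; rewrite E1 E2 => /eqP ->.
split=> [[SA /card_ge2[P [Q [IP IQ PQ]]]]|[_ /mapP[L hL ->]]].
  have I0 : I !=set0 by exists P.
  have [w Qw EI] := (strongly_admissibleP I0).1 SA.
  move: IP IQ PQ; rewrite EI => -[u mu <-] [v mv <-] uv.
  (* Orthogonal isotropic vectors are proportional and would define the same parabolic. *)
  have Q0 : hermQ u v != 0.
    apply/eqP => /(isotropic_orth (proj1 mu) (proj1 mv))[c uc e].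
    by apply: uv; rewrite e line_stab_scale // gunit_neq0.
  have [L hL tL] := minvec_classification Qw mu mv Q0.
  exists [seq vC R x | x <- L]; first by apply: map_f.
  by apply/(Gamma_conjugateP _ hL); exists w.
move=> /(Gamma_conjugateP _ hL)[w Qw [EI [g Gg H]]].
have I2 : exists P Q, [/\ I P, I Q & P <> Q].
  have /hasP[x xL /hasP[y yL xy]] := allP ireps_nonproportional L hL.
  rewrite EI (min_parabolics_type Gg H).
  exists (line_stab (g *m vC R x)), (line_stab (g *m vC R y)).
  split; [by exists x | by exists y |].
  have rx := reps_reduced R hL xL; have ry := reps_reduced R hL yL.
  move=> /(line_stab_inj (reduced_isotropic_act Gg rx) (reduced_isotropic_act Gg ry))[c uc e].
  have : hermQ (g *m vC R x) (g *m vC R y) = 0.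
    by rewrite e hermQZr (SU21_hermQ _ _ (Gamma_SU21 Gg)); have [_ -> _] := rx; rewrite mulr0.
  rewrite (SU21_hermQ _ _ (Gamma_SU21 Gg)) iQP -(gC0 R) => /gC_inj xy0.
  by rewrite xy0 eqxx in xy.
split; last exact/card_ge2.
have I0 : I !=set0 by have [P [_ [IP _ _]]] := I2; exists P.
by apply/(strongly_admissibleP I0); exists w.
Qed.
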